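(* Let $X$ and $Y$ be Banach spaces and let $(S,T)\in RP(X,Y)$ be a regular Fredholm pair whose case is $I-n$ with number $n=p=q\ge 2$. Then there is an adapted decomposition system $(X_1,X_2,\tilde X;Y_1,Y_2,\tilde Y)$ of $(S,T)$ such that, for the subspaces associated with it, $$X=\Big[X_1\oplus\bigoplus_{i=1}^{p-1}\mathbb N^i\Big]\oplus\Big[X_2^{p-1}\oplus\bigoplus_{i=1}^{p-2}\mathbb X_2^i\Big]\oplus[\tilde X_N\oplus\tilde X_2],$$ $$Y=\Big[Y_1\oplus\bigoplus_{i=1}^{p-1}\mathbb M^i\Big]\oplus\Big[Y_2^{p-1}\oplus\bigoplus_{i=1}^{p-2}\mathbb Y_2^i\Big]\oplus[\tilde Y_N\oplus\tilde Y_2],$$ and $S$ and $T$ act as follows (every ''$\xrightarrow{\cong}$'' being the indicated restriction, and an isomorphism of Banach spaces; items whose superscript index is less than $1$ are omitted): $S|_{X_1\oplus\bigoplus_{i=1}^{p-1}\mathbb N^i}\equiv 0$, $S\colon X_2^{p-1}\xrightarrow{\cong}Y_2^{p-1}$, $S\colon\mathbb X_2^i\xrightarrow{\cong}\mathbb M^{i+1}\oplus\mathbb Y_2^{i+1}$ for $i=1,\dots,p-3$, $S\colon\mathbb X_2^{p-2}\xrightarrow{\cong}\mathbb M^{p-1}$, $S\colon\tilde X_N\xrightarrow{\cong}\mathbb M^1$, $S\colon\tilde X_2\xrightarrow{\cong}\mathbb Y_2^1$; $T|_{Y_1\oplus\bigoplus_{i=1}^{p-1}\mathbb M^i}\equiv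 0$, $T\colon Y_2^{p-1}\xrightarrow{\cong}X_2^{p-1}$, $T\colon\mathbb Y_2^i\xrightarrow{\cong}\mathbb N^{i+1}\oplus\mathbb X_2^{i+1}$ for $i=1,\dots,p-3$, $T\colon\mathbb Y_2^{p-2}\xrightarrow{\cong}\mathbb N^{p-1}$, $T\colon\tilde Y_N\xrightarrow{\cong}\mathbb N^1$, $T\colon\tilde Y_2\xrightarrow{\cong}\mathbb X_2^1$. In addition, if $n=2$, then $\mathbb X_2^1$, $\mathbb Y_2^1$, $\tilde X_2$ and $\tilde Y_2$ are null spaces.
   Context: $L(X,Y)$ is the space of bounded linear operators from $X$ to $Y$; $N(\cdot)$ and $R(\cdot)$ denote null space and range; $\mathbb N=\{1,2,\dots\}$, $\mathbb N_0=\mathbb N\cup\{0\}$. Regular Fredholm pairs. For $S\in L(X,Y)$, $T\in L(Y,X)$, $(S,T)$ is a Fredholm pair if $N(S)/(N(S)\cap R(T))$, $R(T)/(N(S)\cap R(T))$, $N(T)/(N(T)\cap R(S))$, $R(S)/(N(T)\cap R(S))$ are all finite dimensional. An operator $T\in L(Y,X)$ is regular if $T=TT'T$ for some $T'\in L(X,Y)$. $RP(X,Y)$ is the set of Fredholm pairs $(S,T)$ with both $S$ and $T$ regular. Number and case. Put $R_{S,0}=Y$, $R_{T,0}=X$, $R_{S,n+1}=S(R_{T,n})$, $R_{T,n+1}=T(R_{S,n})$ for $n\in\mathbb N_0$. These are decreasing sequences of subspaces, finite dimensional for $n\ge 2$. Let $p$ (resp. $q$) be the smallest element of $\mathbb N$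 with $R_{S,p}=R_{S,p+k}$ (resp. $R_{T,q}=R_{T,q+k}$) for all $k\ge 0$; always $|p-q|\le 1$. The number of $(S,T)$ is $n=\min\{p,q\}$, and its case is $I-n$ if $p=q$, $II-n$ if $p<q$, $III-n$ if $q<p$. Decomposition systems. A decomposition system of $(S,T)\in RP(X,Y)$ consists of finite dimensional subspaces $X_1,X_2\subseteq X$, $Y_1,Y_2\subseteq Y$ and closed subspaces $\tilde X\subseteq X$, $\tilde Y\subseteq Y$ with $N(S)=(N(S)\cap R(T))\oplus X_1$, $R(T)=(N(S)\cap R(T))\oplus X_2$, $X=((N(S)\cap R(T))\oplus X_1\oplus X_2)\oplus\tilde X$, $N(T)=(N(T)\cap R(S))\oplus Y_1$, $R(S)=(N(T)\cap R(S))\oplus Y_2$, $Y=((N(T)\cap R(S))\oplus Y_1\oplus Y_2)\oplus\tilde Y$. With it are associated, for $n\in\mathbb N$: $M^n=R_{S,n}\cap N(T)$, $N^n=R_{T,n}\cap N(S)$, $Y_2^n=R_{S,n}\cap Y_2$, $X_2^n=R_{T,n}\cap X_2$; $R_{\tilde S,1}=S(\tilde X)$, $R_{\tilde T,1}=T(\tilde Y)$, $R_{\tilde S,n+1}=S(R_{\tilde T,n})$, $R_{\tilde T,n+1}=T(R_{\tilde S,n})$; $\mathbb M^n=R_{\tilde S,n}\cap N(T)$, $\mathbb N^n=R_{\tilde T,n}\cap N(S)$, $\mathbb Y_2^n=R_{\tilde S,n}\cap Y_2^n$, $\mathbb X_2^n=R_{\tilde T,n}\cap X_2^n$ (here $\mathbb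 N^n$ is a subspace of $X$, not a power of the natural numbers); $\tilde X_N=\{x\in\tilde X: Sx\in\mathbb M^1\}$, $\tilde X_2=\{x\in\tilde X: Sx\in\mathbb Y_2^1\}$, $\tilde Y_N=\{y\in\tilde Y: Ty\in\mathbb N^1\}$, $\tilde Y_2=\{y\in\tilde Y: Ty\in\mathbb X_2^1\}$. The system is called adapted if for all $n\in\mathbb N$: $R_{S,n}=M^n\oplus Y_2^n$, $R_{T,n}=N^n\oplus X_2^n$, $R_{\tilde S,n}=\mathbb M^n\oplus\mathbb Y_2^n$, $R_{\tilde T,n}=\mathbb N^n\oplus\mathbb X_2^n$, $R_{S,n}=R_{S,n+1}\oplus R_{\tilde S,n}$, $R_{T,n}=R_{T,n+1}\oplus R_{\tilde T,n}$. *)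

(* Defs.v *)
From HB Require Import structures.
From mathcomp Require Import all_boot all_order all_algebra.
From mathcomp Require Import complex.
From mathcomp Require Import all_classical all_reals all_analysis.

Set Implicit Arguments.
Unset Strict Implicit.
Unset Printing Implicit Defensive.

Import Order.TTheory GRing.Theory Num.Theory.
Import numFieldNormedType.Exports.

Local Open Scope classical_set_scope.
Local Open Scope ring_scope.

(* Banach spaces are over the real or the complex numbers; a general
   numFieldType (e.g. rat) would be too weak for Banach space theory. *)
Definition real_or_complex (K : numFieldType) : Prop :=
  exists R : realType,
    K = R :> numFieldType \/ K = (R[i] : numFieldType) :> numFieldType.

Definition linear_subspace (K : numFieldType) (V : lmodType K) (A : set V) : Prop :=
  A 0 /\ forall (a : K) (x y : V), A x -> A y -> A (a *: x + y).

Definition finite_dim (K : numFieldType) (V : lmodType K) (A : set V) : Prop :=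
  exists (n : nat) (v : 'I_n -> V),
    A = [set x | exists a : 'I_n -> K, x = \sum_(i < n) a i *: v i].

(* The quotient A / B (for subspaces B `<=` A) is spanned by the classes of
   finitely many elements of A. *)
Definition finite_dim_quotient (K : numFieldType) (V : lmodType K)
    (A B : set V) : Prop :=
  exists (n : nat) (v : 'I_n -> V), (forall i, A (v i)) /\
    forall x, A x -> exists a : 'I_n -> K, B (x - \sum_(i < n) a i *: v i).

Fixpoint sums (K : numFieldType) (V : lmodType K) (s : seq (set V)) : set V :=
  if s is A :: s' then [set x + y | x in A & y in sums s'] else [set 0].

Fixpoint independent (K : numFieldType) (V : lmodType K) (s : seq (set V)) :
    Prop :=
  if s is A :: s' then A `&` sums s' = [set 0] /\ independent s' else True.

(* A is the internal direct sum of the list s of subspaces; iterated direct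
   sums are flattened by associativity. *)
Definition direct_sum (K : numFieldType) (V : lmodType K)
    (A : set V) (s : seq (set V)) : Prop :=
  A = sums s /\ independent s.

Definition nullspace (K : numFieldType) (X Y : lmodType K) (S : X -> Y) : set X :=
  [set x | S x = 0].

(* Equivalent to a norm estimate by linear_boundedP, and to continuity by
   linear_bounded_continuous. *)
Definition bounded_op (K : numFieldType) (X Y : normedModType K)
    (S : {linear X -> Y}) : Prop :=
  bounded_near S (nbhs (0 : X)).

(* The restriction of S is an isomorphism of the Banach space A onto the
   Banach space B: a linear bijection bounded together with its inverse. *)
Definition banach_iso (K : numFieldType) (X Y : completeNormedModType K)
    (S : {linear X -> Y}) (A : set X) (B : set Y) : Prop :=
  [/\ linear_subspace A /\ closed A, linear_subspace B /\ closed B, set_bij A B S,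
      exists C : K, forall x, A x -> `|S x| <= C * `|x| &
      exists C : K, forall x, A x -> `|x| <= C * `|S x|].

Definition fredholm_pair (K : numFieldType) (X Y : normedModType K)
    (S : {linear X -> Y}) (T : {linear Y -> X}) : Prop :=
  [/\ finite_dim_quotient (nullspace S) (nullspace S `&` range T),
      finite_dim_quotient (range T) (nullspace S `&` range T),
      finite_dim_quotient (nullspace T) (nullspace T `&` range S) &
      finite_dim_quotient (range S) (nullspace T `&` range S)].

Definition regular_op (K : numFieldType) (X Y : normedModType K)
    (S : {linear X -> Y}) : Prop :=
  exists S' : {linear Y -> X}, bounded_op S' /\ forall x, S (S' (S x)) = S x.

Definition regular_fredholm_pair (K : numFieldType) (X Y : normedModType K)
    (S : {linear X -> Y}) (T : {linear Y -> X}) : Prop :=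
  [/\ bounded_op S, bounded_op T, fredholm_pair S T, regular_op S & regular_op T].

(* iter_range S T n is R_{S,n}, and iter_range T S n is R_{T,n}. *)
Fixpoint iter_range (X Y : Type) (S : X -> Y) (T : Y -> X) (n : nat) : set Y :=
  if n is m.+1 then S @` iter_range T S m else setT.

Definition stable_from (V : Type) (F : nat -> set V) (n : nat) : Prop :=
  forall k, F n = F (n + k)%N.

(* p is the least n >= 1 from which the sequence F is constant. *)
Definition stabilization_index (V : Type) (F : nat -> set V) (p : nat) : Prop :=
  [/\ (1 <= p)%N, stable_from F p &
      forall n, (1 <= n)%N -> stable_from F n -> (p <= n)%N].

Variant pair_case := CaseI | CaseII | CaseIII.

Definition has_case (X Y : Type) (S : X -> Y) (T : Y -> X)
    (c : pair_case) (n : nat) : Prop :=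
  exists p q : nat,
    [/\ stabilization_index (iter_range S T) p,
        stabilization_index (iter_range T S) q,
        n = minn p q &
        match c with
        | CaseI => p = q
        | CaseII => (p < q)%N
        | CaseIII => (q < p)%N
        end].

Record decomp_data (X Y : Type) := DecompData {
  dX1 : set X; dX2 : set X; dXt : set X;
  dY1 : set Y; dY2 : set Y; dYt : set Y }.

(* The half of a decomposition system living in the domain X of S. *)
Definition half_decomposition (K : numFieldType) (X Y : normedModType K)
    (S : {linear X -> Y}) (T : {linear Y -> X}) (X1 X2 Xt : set X) : Prop :=
  [/\ finite_dim X1 /\ finite_dim X2,
      linear_subspace Xt /\ closed Xt,
      direct_sum (nullspace S) [:: nullspace S `&` range T; X1],
      direct_sum (range T) [:: nullspace S `&` range T; X2] &
      direct_sum setT [:: nullspace S `&` range T; X1; X2; Xt]].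

Definition decomposition_system (K : numFieldType) (X Y : normedModType K)
    (S : {linear X -> Y}) (T : {linear Y -> X}) (D : decomp_data X Y) : Prop :=
  half_decomposition S T (dX1 D) (dX2 D) (dXt D) /\
  half_decomposition T S (dY1 D) (dY2 D) (dYt D).

(* With Xt, Yt the spaces written with a tilde, tilde_range S T Xt Yt n is
   R_{~S,n} and tilde_range T S Yt Xt n is R_{~T,n}, for n >= 1.  The value Yt
   (resp. Xt) at n = 0 only serves to start the recursion, so that
   R_{~S,1} = S(Xt) and R_{~T,1} = T(Yt). *)
Fixpoint tilde_range (X Y : Type) (S : X -> Y) (T : Y -> X)
    (Xt : set X) (Yt : set Y) (n : nat) : set Y :=
  if n is m.+1 then S @` tilde_range T S Yt Xt m else Yt.

Section Associated.
Context (K : numFieldType) (X Y : lmodType K) (S : X -> Y) (T : Y -> X).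
Context (D : decomp_data X Y).

Definition spM (n : nat) : set Y := iter_range S T n `&` nullspace T.
Definition spN (n : nat) : set X := iter_range T S n `&` nullspace S.
Definition spY2 (n : nat) : set Y := iter_range S T n `&` dY2 D.
Definition spX2 (n : nat) : set X := iter_range T S n `&` dX2 D.

Definition tRS (n : nat) : set Y := tilde_range S T (dXt D) (dYt D) n.
Definition tRT (n : nat) : set X := tilde_range T S (dYt D) (dXt D) n.

(* The blackboard-bold spaces. *)
Definition bbM (n : nat) : set Y := tRS n `&` nullspace T.
Definition bbN (n : nat) : set X := tRT n `&` nullspace S.
Definition bbY2 (n : nat) : set Y := tRS n `&` spY2 n.
Definition bbX2 (n : nat) : set X := tRT n `&` spX2 n.

Definition XtN : set X := [set x | dXt D x /\ bbM 1 (S x)].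
Definition Xt2 : set X := [set x | dXt D x /\ bbY2 1 (S x)].
Definition YtN : set Y := [set y | dYt D y /\ bbN 1 (T y)].
Definition Yt2 : set Y := [set y | dYt D y /\ bbX2 1 (T y)].

Definition adapted : Prop := forall n : nat, (1 <= n)%N ->
  [/\ direct_sum (iter_range S T n) [:: spM n; spY2 n] /\
      direct_sum (iter_range T S n) [:: spN n; spX2 n],
      direct_sum (tRS n) [:: bbM n; bbY2 n],
      direct_sum (tRT n) [:: bbN n; bbX2 n],
      direct_sum (iter_range S T n) [:: iter_range S T n.+1; tRS n] &
      direct_sum (iter_range T S n) [:: iter_range T S n.+1; tRT n]].

End Associated.

(* Main.v *)
Require Import Defs.
From HB Require Import structures.
From mathcomp Require Import all_boot all_order all_algebra.
From mathcomp Require Import all_classical all_reals all_analysis.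
From mathcomp Require Import complex ring lra.

(** Write R for the ranges R_{S,n}, R_{T,n}, and A(x, y) = (T y, S x) for the
operator on X x Y that swaps the two summands; R_{S,n} and R_{T,n} are the
components of the range of A^n.  The theorem is the Jordan decomposition of A
compatible with the grading: the part of A on the stable range R_p is
invertible, the rest is nilpotent and is a direct sum of chains
z, A z, ..., A^{l-1} z of length l <= p, and the tilde spaces must be spanned by
the tops z of the chains of length at least two.  Chains of length two may form
an infinite dimensional family; all longer ones are finitely many, because
R_n is finite dimensional for n >= 2.

The whole content is in the choice of the tilde spaces.  The sum of X~ with
N(S) + R(T) has to be direct and equal to X, which gives
R_n = R_{n+1} + A^n(Z~) with Z~ = X~ x Y~ for every n >= 1, but adaptedness also
asks that this sum be direct.  A complement with this property is reached from
an arbitrary one (complement_projection) in finitely many corrections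
(straighten_projection): if A^n x lies in A^{n+1}(X x Y) for some x in X~, then
x is replaced by x - r with r in R(T) and A^n r = A^n x.  Doing this linearly and
continuously needs only a finite rank operator, since A^{n+1}(X x Y) is finite
dimensional, and it changes neither the kernel N(S) + R(T) of the projection onto
X~ nor what holds for smaller exponents (straight_complement).

Once every A^n(Z~) meets R_{n+1} trivially, X_2 is built from the bottom of the
filtration (exists_splitting_space): start with R_{T,p}, on which S is injective
because it is finite dimensional and T S maps it onto itself, and at level n add a
complement of R_{~T,n} /\ N(S) in R_{~T,n}.  What remains is bookkeeping with
direct sums: N(S) /\ R(T) is the sum of the last elements of the chains, X_2 the
sum of the stable part and of the intermediate elements, and S moves each chain
one step forward.

Analysis enters in two places.  Closed complements of finite dimensional spaces
come from the Hahn-Banach theorem over the reals or the complex numbers, proved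
here by Zorn's lemma applied to sublinear functionals: a minimal one is linear.
The bounds for the inverses come either from finite dimension or from a bounded
generalized inverse S': if P is the projection onto X~ along N(S) + R(T), then
P S' is a left inverse of S on X~.  The same formula shows that S(X~) is closed.
The construction treats S and T alike, so that every statement is proved for
one of them and used twice. *)

Set Implicit Arguments.
Unset Strict Implicit.
Unset Printing Implicit Defensive.

Import Order.TTheory GRing.Theory Num.Theory.
Import numFieldNormedType.Exports.

Local Open Scope classical_set_scope.
Local Open Scope ring_scope.

(** * The Hahn-Banach theorem *)

Definition sublinear (R : realType) (V : lmodType R) (p : V -> R) : Prop :=
  (forall x y, p (x + y) <= p x + p y) /\
  (forall t x, 0 <= t -> p (t *: x) = t * p x).

(** Both the lower bound of a chain in Zorn's lemma and the modification in
[sublinear_shave] are pointwise infima; this isolates what makes such an infimum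
sublinear. *)
Lemma inf_sublinear (R : realType) (V : lmodType R) (F : V -> set R) :
  (forall x, F x !=set0) -> (forall x, has_lbound (F x)) ->
  (forall x y a b, F x a -> F y b -> exists2 c, F (x + y) c & c <= a + b) ->
  (forall s x a, 0 < s -> F x a -> exists2 c, F (s *: x) c & c <= s * a) ->
  sublinear (fun x => inf (F x)).
Proof.
move=> F0 Flb FD FZ; pose p x := inf (F x).
have hi x : has_inf (F x) by split.
have scale_le s x : 0 < s -> p (s *: x) <= s * p x.
  move=> s0; rewrite -ler_pdivrMl//; apply: lb_le_inf => // a Fa.
  have [c Fc ca] := FZ s x a s0 Fa.
  by rewrite ler_pdivrMl//; apply: le_trans ca; exact: ge_inf.
have scale s x : 0 < s -> p (s *: x) = s * p x.
  move=> s0; apply/eqP; rewrite eq_le scale_le//=.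
  have := scale_le s^-1 (s *: x); rewrite invr_gt0 => /(_ s0).
  by rewrite scalerA mulVf ?gt_eqF// scale1r ler_pdivlMl.
split=> [x y|t x]; last first.
  rewrite le_eqVlt => /predU1P[<-|t0]; last exact: scale.
  rewrite scale0r mul0r; have := scale 2 0 ltac:(by []).
  rewrite scaler0 /p; lra.
apply/ler_addgt0Pl => e e0.
have e2 : 0 < e / 2 by rewrite divr_gt0.
have [a Fa lta] := inf_adherent e2 (hi x).
have [b Fb ltb] := inf_adherent e2 (hi y).
have [c Fc lec] := FD _ _ _ _ Fa Fb.
have := ge_inf (Flb (x + y)) Fc.
lra.
Qed.

Lemma sublinear0 (R : realType) (V : lmodType R) (p : V -> R) :
  sublinear p -> p 0 = 0.
Proof. by case=> _ /(_ 0 0 (lexx _)); rewrite scaler0 mul0r. Qed.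

Lemma sublinear_ge (R : realType) (V : lmodType R) (p : V -> R) x :
  sublinear p -> - p (- x) <= p x.
Proof.
by move=> sp; have := sp.1 x (- x); rewrite subrr sublinear0 //; lra.
Qed.

(** The minorant is the infimum of [p (x + t *: y) - t * p y] over [t >= 0].  A
minimal [p] equals it, so that [p (- y) <= - p y] for every [y]: such a [p] is odd,
hence linear. *)
Lemma sublinear_shave (R : realType) (V : lmodType R) (p : V -> R) (y : V) :
  sublinear p ->
  exists r : V -> R,
    [/\ sublinear r, forall x, r x <= p x & r (- y) <= - p y].
Proof.
move=> sp; have [pD pZ] := sp.
pose F x := [set p (x + t *: y) - t * p y | t in [set t | 0 <= t]].
have Flb x : has_lbound (F x).
  exists (- p (- x)) => _ [t /= t0 <-].
  have := pD (x + t *: y) (- x); rewrite addrAC subrr add0r pZ//; lra.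
exists (fun x => inf (F x)); split.
- apply: inf_sublinear => //.
  + by move=> x; exists (p (x + 0 *: y) - 0 * p y); exists 0 => /=.
  + move=> x z _ _ [s /= s0 <-] [t /= t0 <-].
    exists (p (x + z + (s + t) *: y) - (s + t) * p y).
      by exists (s + t) => //=; rewrite addr_ge0.
    by have := pD (x + s *: y) (z + t *: y); rewrite addrACA -scalerDl; lra.
  + move=> s x _ s0 [t /= t0 <-].
    exists (p (s *: x + (s * t) *: y) - (s * t) * p y).
      by exists (s * t) => //=; rewrite mulr_ge0// ltW.
    by rewrite -scalerA -scalerDr (pZ _ _ (ltW s0)) mulrBr mulrA.
- move=> x; apply: ge_inf => //; exists 0 => //=.
  by rewrite scale0r addr0 mul0r subr0.
- apply: ge_inf => //; exists 1 => //=.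
  by rewrite scale1r addNr sublinear0// mul1r sub0r.
Qed.

Lemma exists_minimal_sublinear (R : realType) (V : lmodType R) (q : V -> R) :
  sublinear q ->
  exists p : V -> R, [/\ sublinear p, forall x, p x <= q x &
    forall r : V -> R, sublinear r -> (forall x, r x <= p x) ->
      forall x, p x <= r x].
Proof.
move=> sq; pose T := {p : V -> R | sublinear p /\ forall x, p x <= q x}.
pose q0 : T := exist _ q (conj sq (fun x => lexx _)).
pose le (f g : T) := `[< forall x, sval g x <= sval f x >].
have [||A Atot|[p [sp pq]] pmax] := @ZL_preorder T q0 le.
- by move=> t; apply/asboolP.
- move=> r s t /asboolP rs /asboolP st; apply/asboolP => x.
  exact: le_trans (rs x).
- have [A0|/set0P[f0 Af0]] := eqVneq A set0.
    by exists q0 => s; rewrite A0.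
  pose F x := [set sval f x | f in A].
  have Flb x : has_lbound (F x).
    exists (- q (- x)) => _ [[f [sf fq]] _ <-] /=.
    by have := sublinear_ge x sf; have := fq (- x); lra.
  have sF : sublinear (fun x => inf (F x)).
    apply: inf_sublinear => //.
    + by move=> x; exists (sval f0 x), f0.
    + move=> x y _ _ [f Af <-] [g Ag <-].
      have [/asboolP fg|/asboolP gf] := Atot f g Af Ag.
        exists (sval g (x + y)); first by exists g.
        by have := (proj1 (svalP g)).1 x y; have := fg x; lra.
      exists (sval f (x + y)); first by exists f.
      by have := (proj1 (svalP f)).1 x y; have := gf y; lra.
    + move=> s x _ s0 [f Af <-]; exists (sval f (s *: x)); first by exists f.
      by rewrite (proj1 (svalP f)).2 // ltW.
  have Fq x : inf (F x) <= q x.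
    apply: le_trans (proj2 (svalP f0) x).
    by apply: ge_inf => //; exists f0.
  pose g0 : T := exist _ (fun x => inf (F x)) (conj sF Fq).
  exists g0 => f Af; apply/asboolP => x /=.
  by apply: ge_inf => //; exists f.
exists p; split=> // r sr rp x.
have rq z : r z <= q z by exact: le_trans (rp z) (pq z).
pose r0 : T := exist _ r (conj sr rq).
have := pmax r0.
by move=> /(_ ltac:(exact/asboolP)) /asboolP /(_ x).
Qed.

(** Shaving [q] at [x0] before minimizing forces the linear minorant to touch [q]
at [x0]. *)
Lemma hahn_banach_sublinear (R : realType) (V : lmodType R) (q : V -> R)
    (x0 : V) : sublinear q ->
  exists f : V -> R, [/\ linear (f : V -> R^o), forall x, f x <= q x &
    f x0 = q x0].
Proof.
move=> sq; have [r [sr rq rx0]] := sublinear_shave x0 sq.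
have [p [sp pr pmin]] := exists_minimal_sublinear sr.
have pN y : p (- y) = - p y.
  have [s [ss sp' sy]] := sublinear_shave y sp.
  have := pmin s ss sp' (- y); have := sublinear_ge y sp; lra.
have pq x : p x <= q x by exact: le_trans (pr x) (rq x).
exists p; split=> //.
- have pD x y : p (x + y) = p x + p y.
    have := sp.1 x y; have := sp.1 (- x) (- y); rewrite -opprD !pN; lra.
  move=> a x y; rewrite pD; congr (_ + _).
  have [a0|a0] := leP 0 a; first exact: sp.2.
  rewrite -{1}[a]opprK scaleNr pN sp.2 ?oppr_ge0 ?(ltW a0)//.
  by rewrite mulNr opprK.
- have := pr (- x0); rewrite pN; have := pq x0; lra.
Qed.

(** A complex vector space with real scalars only, so that the real theorem
applies to it. *)
Definition realification (R : realType) (V : lmodType R[i]) : Type := V.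

Section Realification.
Variables (R : realType) (V : lmodType R[i]).
HB.instance Definition _ := GRing.Zmodule.on (@realification R V).

Definition real_scale (a : R) (x : realification V) : realification V :=
  (a%:C)%C *: (x : V).

Fact real_scaleA a b v : real_scale a (real_scale b v) = real_scale (a * b) v.
Proof. by rewrite /real_scale scalerA -rmorphM. Qed.
Fact real_scale1 : left_id 1 real_scale.
Proof. by move=> v; rewrite /real_scale scale1r. Qed.
Fact real_scaleDr : right_distributive real_scale +%R.
Proof. by move=> a u v; rewrite /real_scale scalerDr. Qed.
Fact real_scaleDl v : {morph real_scale^~ v : a b / a + b}.
Proof. by move=> a b; rewrite /real_scale rmorphD scalerDl. Qed.

HB.instance Definition _ := GRing.Zmodule_isLmodule.Build R
  (@realification R V) real_scaleA real_scale1 real_scaleDr real_scaleDl.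
End Realification.

(** Linearity and boundedness of a bare function: the functionals and projections
below come out of existence statements, and this form avoids bundling them. *)
Definition bounded_linear (K : numFieldType) (V W : normedModType K)
    (f : V -> W) : Prop :=
  linear f /\ exists2 C, 0 <= C & forall x, `|f x| <= C * `|x|.

(** The only consequence of Hahn-Banach used later, isolated so that the rest is
independent of the field of scalars. *)
Definition points_separated (K : numFieldType) (V : normedModType K) : Prop :=
  forall x : V, x != 0 ->
    exists2 f : V -> K^o, bounded_linear f & f x = 1.

Lemma real_points_separated (R : realType) (V : normedModType R) :
  points_separated V.
Proof.
move=> x x0; pose q (v : V) : R := `|v|.
have sq : sublinear q.
  split=> [u v|t v t0]; first exact: ler_normD.
  by rewrite /q normrZ ger0_norm.
have [f [lf fq fx]] := hahn_banach_sublinear x sq.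
have nx : `|x| != 0 by rewrite normr_eq0.
exists (fun v => `|x|^-1 * f v); last by rewrite fx mulVf.
split=> [a u v|].
  rewrite lf mulrDr /GRing.scale /=; congr (_ + _).
  by rewrite mulrCA.
exists `|x|^-1; first by rewrite invr_ge0.
move=> v; rewrite normrM ger0_norm ?invr_ge0// ler_wpM2l ?invr_ge0//.
have fN : f (- v) = - f v.
  have := lf (-1) v 0; rewrite addr0 scaleN1r => ->.
  have := lf (-1) 0 0; rewrite scaler0 addr0 /GRing.scale /=; lra.
have := fq v; have := fq (- v); rewrite fN /q normrN ler_norml => h1 ->.
by rewrite andbT lerNl.
Qed.

(** A complex functional is recovered from its real part [f] as
[f v - 'i * f ('i *: v)]. *)
Lemma complex_points_separated (R : realType) (V : normedModType R[i]) :
  points_separated V.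
Proof.
move=> x x0; pose q (v : realification V) : R := complex.Re `|v : V|.
have qE (v : V) : (q v)%:C%C = `|v|.
  by rewrite RRe_real// realE normr_ge0.
have sq : sublinear q.
  split=> [u v|t v t0].
    have : `|(u : V) + v| <= `|u : V| + `|v : V| by exact: ler_normD.
    by rewrite -!qE -rmorphD lecR.
  apply: (@complexI R); rewrite qE rmorphM /= qE.
  rewrite [LHS]normrZ; congr (_ * _).
  by rewrite ger0_norm// ler0c.
have [f [lf fq fx]] := hahn_banach_sublinear (x : realification V) sq.
have fD u v : f (u + v) = f u + f v.
  by have := lf 1 u v; rewrite !scale1r.
have fZ a (u : V) : f ((a%:C)%C *: u) = a * f u.
  have f0 : f 0 = 0 by have := fD 0 0; rewrite addr0; lra.
  have := lf a u 0; rewrite addr0 f0 addr0; exact.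
have fN u : f (- u) = - f u.
  have -> : - u = ((-1)%:C)%C *: (u : V) by rewrite rmorphN1 scaleN1r.
  by rewrite fZ mulN1r.
have fle (v : V) : `|f v| <= q v.
  have := fq v; have := fq (- v).
  rewrite fN /q [`|- _|]normrN ler_norml => h1 ->.
  by rewrite andbT lerNl.
pose g (v : V) : R[i] := (f v +i* - f ('i%C *: v))%C.
have lg : linear (g : V -> R[i]^o).
  move=> a u v; case: a => a b.
  have ab : (a +i* b)%C = a%:C%C + b%:C%C * 'i%C.
    by simpc.
  have E1 : f ((a +i* b)%C *: u + v) = a * f u + b * f ('i%C *: u) + f v.
    by rewrite fD ab scalerDl fD fZ -scalerA fZ.
  have E2 : f ('i%C *: ((a +i* b)%C *: u + v)) =
      a * f ('i%C *: u) - b * f u + f ('i%C *: v).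
    have -> : 'i%C *: ((a +i* b)%C *: u + v) =
        a%:C%C *: ('i%C *: u) + b%:C%C *: (- u) + 'i%C *: v.
      rewrite scalerDr ab scalerA mulrDr scalerDl mulrCA -expr2 sqr_i mulrN1.
      by rewrite [_ * a%:C%C]mulrC -scalerA scaleNr scalerN.
    by rewrite !fD !fZ fN mulrN.
  rewrite /g E1 E2 /GRing.scale /=; apply/eqP; rewrite eq_complex /=.
  by apply/andP; split; apply/eqP; ring.
have gle v : `|g v| <= 2 * `|v|.
  have -> : g v = (f v)%:C%C - 'i%C * (f ('i%C *: v))%:C%C.
    by rewrite /g; simpc.
  have ni : `|'i%C : R[i]| = 1.
    by rewrite normc_def /= expr0n expr1n add0r sqrtr1.
  apply: (le_trans (ler_normB _ _)); rewrite mulr2n mulrDl mul1r.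
  have nf (w : V) : `|(f w)%:C%C| <= `|w|.
    rewrite -[`|w|]qE normc_def /= expr0n addr0 sqrtr_sqr lecR; exact: fle.
  apply: lerD => //; rewrite normrM ni mul1r.
  by apply: le_trans (nf _) _; rewrite normrZ ni mul1r.
have gx : g x != 0.
  apply/eqP => /(congr1 (@complex.Re R)); rewrite /g /= fx => q0.
  by move: x0; rewrite -normr_eq0 -qE q0 eqxx.
exists (fun v => (g x)^-1 * g v); last by rewrite mulVf.
split=> [a u v|].
  by rewrite lg mulrDr /GRing.scale /= mulrCA.
exists (`|(g x)^-1| * 2); first by rewrite mulr_ge0.
by move=> v; rewrite normrM -mulrA ler_wpM2l.
Qed.

Lemma banach_points_separated (K : numFieldType) (V : normedModType K) :
  real_or_complex K -> points_separated V.
Proof.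
move=> [R [E|E]]; subst K.
  exact: real_points_separated.
exact: complex_points_separated.
Qed.

(** * Subspaces and direct sums *)

Section Subspaces.
Variables (K : numFieldType) (V W : lmodType K).
Implicit Types (A B C : set V).

Lemma subspaceD A x y : linear_subspace A -> A x -> A y -> A (x + y).
Proof. by move=> sA Ax Ay; rewrite -[x]scale1r; exact: sA.2. Qed.

Lemma subspaceZ A a x : linear_subspace A -> A x -> A (a *: x).
Proof. by move=> sA Ax; rewrite -[_ *: _]addr0; apply: sA.2 => //; exact: sA.1. Qed.

Lemma subspaceN A x : linear_subspace A -> A x -> A (- x).
Proof. by move=> sA Ax; rewrite -scaleN1r; exact: subspaceZ. Qed.

Lemma subspaceB A x y : linear_subspace A -> A x -> A y -> A (x - y).
Proof. by move=> sA Ax Ay; apply: subspaceD => //; exact: subspaceN. Qed.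

Lemma subspace_sum A n (a : 'I_n -> K) (v : 'I_n -> V) :
  linear_subspace A -> (forall i, A (v i)) -> A (\sum_(i < n) a i *: v i).
Proof.
move=> sA Av; elim/big_ind: _ => [|x y|i _]; first exact: sA.1.
  exact: subspaceD.
exact: subspaceZ.
Qed.

Lemma subspaceI A B :
  linear_subspace A -> linear_subspace B -> linear_subspace (A `&` B).
Proof.
move=> sA sB; split; first by split; [exact: sA.1|exact: sB.1].
by move=> a x y [Ax Bx] [Ay By]; split; [exact: sA.2|exact: sB.2].
Qed.

Lemma subspaceT : linear_subspace (@setT V).
Proof. by []. Qed.

Lemma subspace0 : linear_subspace [set 0 : V].
Proof. by split=> // a x y -> ->; rewrite scaler0 addr0. Qed.

Lemma subspace_image (f : V -> W) A :
  linear f -> linear_subspace A -> linear_subspace (f @` A).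
Proof.
move=> lf sA; split.
  exists 0; first exact: sA.1.
  by have := lf (-1) 0 0; rewrite !scaleN1r !addNr.
move=> a _ _ [x Ax <-] [y Ay <-]; exists (a *: x + y); first exact: sA.2.
exact: lf.
Qed.

Lemma subspace_preimage (f : V -> W) (B : set W) :
  linear f -> linear_subspace B -> linear_subspace (f @^-1` B).
Proof.
move=> lf sB; split.
  rewrite /preimage /=; have := lf (-1) 0 0; rewrite !scaleN1r !addNr => ->.
  exact: sB.1.
by move=> a x y Bx By; rewrite /preimage /= lf; exact: sB.2.
Qed.

Lemma subspace_nullspace (f : V -> W) : linear f -> linear_subspace (nullspace f).
Proof.
move=> lf; split; first by have := lf (-1) 0 0; rewrite !scaleN1r !addNr.
by move=> a x y /= fx fy; rewrite /nullspace /= lf fx fy scaler0 addr0.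
Qed.

Lemma subspace_sums (s : seq (set V)) :
  List.Forall (@linear_subspace K V) s -> linear_subspace (sums s).
Proof.
elim: s => [_|A s IH /List.Forall_cons_iff[sA /IH ss]] /=; first exact: subspace0.
split; first by exists 0; [exact: sA.1|exists 0; [exact: ss.1|rewrite addr0]].
move=> a _ _ [x Ax [y sy <-]] [x' Ax' [y' sy' <-]].
exists (a *: x + x'); first exact: sA.2.
exists (a *: y + y'); first exact: ss.2.
by rewrite scalerDr addrACA.
Qed.

Lemma subspace_span n (v : 'I_n -> V) :
  linear_subspace [set x | exists a : 'I_n -> K, x = \sum_(i < n) a i *: v i].
Proof.
split; first by exists (fun=> 0); rewrite big1// => i _; rewrite scale0r.
move=> a _ _ [b ->] [c ->]; exists (fun i => a * b i + c i).
rewrite scaler_sumr -big_split /=; apply: eq_bigr => i _.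
by rewrite scalerA scalerDl.
Qed.

Lemma finite_dim_subspace A : finite_dim A -> linear_subspace A.
Proof. by move=> [n [v ->]]; exact: subspace_span. Qed.

End Subspaces.

Lemma packed_linear (K : numFieldType) (V W : lmodType K) (f : V -> W) :
  linear f -> exists F : {linear V -> W}, F = f :> (V -> W).
Proof.
move=> lf; pose m := GRing.isLinear.Build K V W *:%R f lf.
pose F : {linear V -> W} := HB.pack f m.
by exists F.
Qed.

Section DirectSum.
Variables (K : numFieldType) (V : lmodType K).
Implicit Types (A B C : set V).

Lemma direct_sum2I A B C : linear_subspace A -> linear_subspace B ->
  linear_subspace C -> B `<=` A -> C `<=` A ->
  (forall x, A x -> exists b c, [/\ B b, C c & b + c = x]) ->
  (forall x, B x -> C x -> x = 0) -> direct_sum A [:: B; C].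
Proof.
move=> sA sB sC BA CA AE BC; split=> /=.
  apply/seteqP; split=> [x /AE[b [c [Bb Cc <-]]]|_ [b Bb [_ [c Cc [_ -> <-]] <-]]].
    exists b => //; exists c; last by [].
    by exists c => //; exists 0 => //; rewrite addr0.
  by rewrite addr0; apply: subspaceD => //; [exact: BA|exact: CA].
split; last split=> //.
  apply/seteqP; split=> [x [Bx [c Cc [_ -> cx]]]|_ ->] /=.
    by apply: BC => //; rewrite -cx addr0.
  split; first exact: sB.1.
  by exists 0; [exact: sC.1|exists 0 => //; rewrite addr0].
apply/seteqP; split=> [x [_ ->]//|_ ->]; split=> //; exact: sC.1.
Qed.

Lemma direct_sum2E A B C : direct_sum A [:: B; C] ->
  [/\ forall b c, B b -> C c -> A (b + c),
    forall x, A x -> exists b c, [/\ B b, C c & b + c = x] &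
    forall x, B x -> C x -> x = 0].
Proof.
move=> [/= -> [BC _]]; split.
- move=> b c Bb Cc; exists b => //; exists c => //; exists c => //.
  by exists 0 => //; rewrite addr0.
- by move=> x [b Bb [_ [c Cc [_ -> <-]] <-]]; exists b, c; rewrite addr0.
- move=> x Bx Cx; suff : [set 0] x by [].
  by rewrite -BC; split=> //; exists x => //; exists 0 => //; rewrite addr0.
Qed.

Lemma direct_sum_cons A B C s :
  direct_sum A [:: B; C] -> direct_sum C s -> direct_sum A (B :: s).
Proof.
have sums1 : sums [:: C] = C.
  apply/seteqP; split=> [_ [c Cc [_ -> <-]]|c Cc] /=; first by rewrite addr0.
  by exists c => //; exists 0 => //; rewrite addr0.
have sumsB r : sums (B :: r) = [set x + y | x in B & y in sums r] by [].
move=> [AE [BC _]] [CE Is]; split; first by rewrite AE !sumsB -CE sums1.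
by split=> //; rewrite -CE -sums1.
Qed.

(** The blocks of the final decomposition are found separately; this lemma
assembles them into one flat list of summands. *)
Lemma direct_sum_cat A B C s1 s2 :
  linear_subspace A -> linear_subspace C -> List.Forall (@linear_subspace K V) s1 ->
  direct_sum A [:: B; C] -> direct_sum B s1 -> direct_sum C s2 ->
  direct_sum A (s1 ++ s2).
Proof.
move=> + sC; elim: s1 A B => [|D s1 IH] A B sA.
  move=> _ dA [BE _] dC; suff -> : A = C by [].
  have [BCA AE _] := direct_sum2E dA; rewrite BE in BCA AE.
  apply/seteqP; split=> [x /AE[_ [c [-> Cc <-]]]|x Cx]; first by rewrite add0r.
  by rewrite -[x]add0r; exact: BCA.
move=> /List.Forall_cons_iff[sD ss1] dA [BE [D0 Is1]] dC.
have [BCA AE BC] := direct_sum2E dA.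
pose B' := sums s1; have sB' : linear_subspace B' by exact: subspace_sums.
have DB x y : D x -> B' y -> B (x + y).
  by move=> Dx By; rewrite BE; exists x => //; exists y.
have B'B x : B' x -> B x.
  by move=> Bx; rewrite -[x]add0r; apply: DB => //; exact: sD.1.
pose A' := sums [:: B'; C].
have sA' : linear_subspace A' by apply: subspace_sums; do 2 constructor=> //.
have A'E x : A' x -> exists b c, [/\ B' b, C c & b + c = x].
  by move=> [b Bb [_ [c Cc [_ -> <-]] <-]]; exists b, c; rewrite addr0.
have A'I b c : B' b -> C c -> A' (b + c).
  move=> Bb Cc; exists b => //; exists c => //; exists c => //.
  by exists 0 => //; rewrite addr0.
have dA' : direct_sum A' [:: B'; C].
  apply: direct_sum2I => //.
  - by move=> b Bb; rewrite -[b]addr0; apply: A'I => //; exact: sC.1.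
  - by move=> c Cc; rewrite -[c]add0r; apply: A'I => //; exact: sB'.1.
  - by move=> x /B'B; exact: BC.
apply: (direct_sum_cons (C := A')); last exact: (IH A' B').
apply: direct_sum2I => //.
- move=> x Dx; rewrite -[x]addr0; apply: BCA; last exact: sC.1.
  by rewrite -[x]addr0; apply: DB => //; exact: sB'.1.
- by move=> _ /A'E[b [c [/B'B Bb Cc <-]]]; exact: BCA.
- move=> x /AE[b [c []]]; rewrite BE => -[d Dd [b' Bb' <-]] Cc <-.
  by exists d, (b' + c); rewrite addrA; split=> //; exact: A'I.
- move=> x Dx /A'E[b [c [Bb Cc bc]]].
  have c0 : c = 0.
    apply: BC => //; have -> : c = x + - b by rewrite -bc addrAC subrr add0r.
    by apply: DB => //; exact: subspaceN.
  suff : [set 0] x by [].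
  by rewrite -D0; split=> //; rewrite -bc c0 addr0.
Qed.

Lemma direct_sum_swap A B C s : linear_subspace B -> linear_subspace C ->
  linear_subspace (sums s) ->
  direct_sum A [:: B, C & s] -> direct_sum A [:: C, B & s].
Proof.
move=> sB sC ss [-> [B0 [C0 Is]]]; split.
  apply/seteqP; split=> _ [x Bx [_ [y Cy [z sz <-]] <-]].
    by exists y => //; exists (x + z); [exists x => //; exists z|rewrite addrCA].
  by exists y => //; exists (x + z); [exists x => //; exists z|rewrite addrCA].
have B0' b c z : B b -> C c -> sums s z -> b = c + z -> b = 0.
  move=> Bb Cc sz E; suff : [set 0] b by [].
  by rewrite -B0; split=> //; exists c => //; exists z.
split.
  apply/seteqP; split=> [c [Cc [b Bb [z sz bz]]]|_ ->]; last first.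
    split; first exact: sC.1.
    by exists 0; [exact: sB.1|exists 0; [exact: ss.1|rewrite addr0]].
  have b0 : b = 0.
    apply: (B0' b c (- z)) => //; first exact: subspaceN.
    by rewrite -bz addrK.
  suff : [set 0] c by [].
  by rewrite -C0; split=> //; rewrite -bz b0 add0r.
split=> //; apply/seteqP; split=> [b [Bb sb]|_ ->].
  by apply: (B0' b 0 b) => //; [exact: sC.1|rewrite add0r].
by split; [exact: sB.1|exact: ss.1].
Qed.

End DirectSum.

(** * Finite dimensional subspaces *)

Section FiniteDim.
Variables (K : numFieldType) (V W : lmodType K).

Lemma finite_dim_image (f : V -> W) (A : set V) :
  linear f -> finite_dim A -> finite_dim (f @` A).
Proof.
move=> /packed_linear[F <-] [n [v ->]]; exists n, (F \o v).
apply/seteqP; split=> [_ [_ [a ->] <-]|_ [a ->]] /=.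
  by exists a; rewrite linear_sum; apply: eq_bigr => i _; rewrite linearZ.
exists (\sum_(i < n) a i *: v i); first by exists a.
by rewrite linear_sum; apply: eq_bigr => i _; rewrite linearZ.
Qed.

Lemma finite_dim0 : finite_dim [set 0 : V].
Proof.
exists 0, (fun=> 0); apply/seteqP; split=> [_ ->|_ [a ->]] /=.
  by exists (fun=> 0); rewrite big_ord0.
by rewrite big_ord0.
Qed.

Lemma finite_dim_addline (A : set V) (v : V) :
  finite_dim A -> finite_dim [set x | exists a, A (x - a *: v)].
Proof.
move=> [n [w ->]].
exists n.+1, (fun k => if unlift ord0 k is Some i then w i else v).
apply/seteqP; split=> [x [a [b xE]]|x [b ->]].
  exists (fun k => if unlift ord0 k is Some i then b i else a).
  rewrite big_ord_recl unlift_none.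
  under eq_bigr do rewrite liftK.
  by rewrite -xE addrC subrK.
exists (b ord0), (fun i => b (lift ord0 i)).
rewrite big_ord_recl unlift_none addrAC subrr add0r.
by apply: eq_bigr => i _; rewrite liftK.
Qed.

(** By induction on the number of vectors that span [A] modulo [B]: the last vector
either adds nothing, or one line to the complement. *)
Lemma finite_dim_complement n (v : 'I_n -> V) (A B : set V) :
  linear_subspace A -> linear_subspace B ->
  (forall x, A x -> exists a : 'I_n -> K, B (x - \sum_(i < n) a i *: v i)) ->
  exists C, [/\ finite_dim C, C `<=` A & direct_sum A [:: A `&` B; C]].
Proof.
elim: n v A B => [|n IH] v A B sA sB AB.
  have AsB x : A x -> B x.
    by move=> /AB[a]; rewrite big_ord0 subr0.
  exists [set 0]; split; first exact: finite_dim0.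
    by move=> _ ->; exact: sA.1.
  apply: direct_sum2I => //; first exact: subspaceI.
  - exact: subspace0.
  - by move=> _ ->; exact: sA.1.
  - by move=> x Ax; exists x, 0; split=> //; [split=> //; exact: AsB|rewrite addr0].
pose w i := v (lift ord0 i).
pose B' := [set x | exists a : 'I_n -> K, B (x - \sum_(i < n) a i *: w i)].
have sB' : linear_subspace B'.
  split.
    exists (fun=> 0); rewrite big1 ?subr0; first exact: sB.1.
    by move=> i _; rewrite scale0r.
  move=> a x y [b Bb] [c Bc]; exists (fun i => a * b i + c i).
  have -> : \sum_(i < n) (a * b i + c i) *: w i =
      a *: (\sum_(i < n) b i *: w i) + \sum_(i < n) c i *: w i.
    rewrite scaler_sumr -big_split /=; apply: eq_bigr => i _.
    by rewrite scalerA scalerDl.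
  rewrite opprD addrACA -scalerBr; exact: sB.2.
have BB' x : B x -> B' x.
  move=> Bx; exists (fun=> 0); rewrite big1 ?subr0//.
  by move=> i _; rewrite scale0r.
have [|C [fC CA' dC]] := IH w (A `&` B') B (subspaceI sA sB') sB.
  by move=> x [Ax [a]]; exists a.
have [_ A'E BC] := direct_sum2E dC.
have sC := finite_dim_subspace fC.
have [AsB'|nAsB'] := pselect (A `<=` B').
  have AAB' : A `&` B' = A by apply/setIidPl.
  by rewrite AAB' in CA' dC; exists C.
have [u [Au nB'u]] : exists u, A u /\ ~ B' u.
  apply: contra_notP nAsB' => /forallNP h x Ax.
  by apply: contrapT => nB; apply: (h x).
have AB'u x : A x -> exists a, B' (x - a *: u).
  have B'0 y : A y -> exists b, B' (y - b *: v ord0).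
    move=> /AB[b]; rewrite big_ord_recl opprD addrA => Bb.
    by exists (b ord0), (fun i => b (lift ord0 i)).
  move=> /B'0[b Bb]; have [c Bc] := B'0 u Au.
  have c0 : c != 0.
    by apply/eqP => c0; apply: nB'u; move: Bc; rewrite c0 scale0r subr0.
  exists (b / c); have := subspaceB sB' Bb (subspaceZ (b / c) sB' Bc).
  by rewrite scalerBr scalerA divfK// opprB addrA subrK.
have CA x : C x -> A x by move=> /CA'[].
have fC' := finite_dim_addline u fC.
have C'A : [set x | exists a, C (x - a *: u)] `<=` A.
  move=> x [a Cx]; rewrite -[x](subrK (a *: u)); apply: subspaceD => //.
    exact: CA.
  exact: subspaceZ.
exists [set x | exists a, C (x - a *: u)]; split => //.
apply: direct_sum2I => //.
- exact: subspaceI.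
- exact: finite_dim_subspace.
- move=> x Ax; have [a B'x] := AB'u x Ax.
  have Axu : A (x - a *: u) by apply: subspaceB => //; exact: subspaceZ.
  have [b [c [[[Ab _] Bb] Cc bc]]] := A'E _ (conj Axu B'x).
  exists b, (c + a *: u); split=> //.
    by exists a; rewrite addrK.
  by rewrite addrA bc subrK.
- move=> x [Ax Bx] [a Cx].
  have a0 : a = 0.
    apply/eqP; apply: contrapT => /negP a0; apply: nB'u.
    rewrite -[u](scalerK a0); apply: subspaceZ => //.
    rewrite -[a *: u](subKr x); apply: subspaceB => //; first exact: BB'.
    by case: (CA' _ Cx).
  move: Cx; rewrite a0 scale0r subr0 => Cx.
  by apply: BC => //; split=> //; split=> //; exact: BB'.
Qed.

Lemma finite_dim_inter0 n (v : 'I_n -> V) (A B : set V) :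
  linear_subspace A -> linear_subspace B ->
  (forall x, A x -> exists a : 'I_n -> K, B (x - \sum_(i < n) a i *: v i)) ->
  (forall x, A x -> B x -> x = 0) -> finite_dim A.
Proof.
move=> sA sB AB AB0.
have [C [fC CA dC]] := finite_dim_complement sA sB AB.
suff -> : A = C by [].
apply/seteqP; split=> // x Ax.
have [_ /(_ x Ax)[b [c [[Ab Bb] Cc <-]]] _] := direct_sum2E dC.
by rewrite (AB0 b Ab Bb) add0r.
Qed.

Lemma finite_dim_sub (A B : set V) :
  linear_subspace A -> finite_dim B -> A `<=` B -> finite_dim A.
Proof.
move=> sA [n [v BE]] AB.
apply: (finite_dim_inter0 (v := v) sA (@subspace0 _ _)) => // x /AB.
by rewrite BE => -[a ->]; exists a; rewrite subrr.
Qed.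

(** A kernel vector expresses the image of one vector of a spanning family through
the images of the others, so the image of a minimal spanning family could be
shortened. *)
Lemma surjective_endo_inj (A : set V) (f : V -> V) :
  linear f -> finite_dim A -> f @` A = A -> forall x, A x -> f x = 0 -> x = 0.
Proof.
move=> /packed_linear[F <-] [n0 [v0 AE0]] fA x Ax fx.
pose P n := `[< exists v : 'I_n -> V,
  A = [set x | exists a : 'I_n -> K, x = \sum_(i < n) a i *: v i] >].
have exP : exists n, P n by exists n0; apply/asboolP; exists v0.
case: (ex_minnP exP) => -[|n] /asboolP[v AE] nmin.
  by move: Ax; rewrite AE => -[a ->]; rewrite big_ord0.
have : x = 0 \/ x <> 0 by exact: EM.
case=> // x0; exfalso.
have [a xE] : exists a : 'I_n.+1 -> K, x = \sum_(i < n.+1) a i *: v i.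
  by move: Ax; rewrite AE.
have [i0 ai0] : exists i, a i != 0.
  apply: contrapT => /forallNP a0; apply: x0; rewrite xE big1// => i _.
  by move/negP: (a0 i); rewrite negbK => /eqP ->; rewrite scale0r.
suff : P n by move=> /nmin; rewrite ltnn.
apply/asboolP; exists (fun i => F (v (lift i0 i))).
rewrite -fA AE; apply/seteqP; split=> [_ [_ [b ->] <-]|_ [b ->]] /=.
  exists (fun i => b (lift i0 i) - b i0 / a i0 * a (lift i0 i)).
  have Fv : F (v i0) =
      - ((a i0)^-1 *: \sum_(i < n) a (lift i0 i) *: F (v (lift i0 i))).
    apply/eqP; rewrite -addr_eq0 -[F _](scalerK ai0) -scalerDr.
    move: fx; rewrite xE (bigD1_ord i0)//= linearD linearZ linear_sum /=.
    under eq_bigr do rewrite linearZ /=.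
    by move=> ->; rewrite scaler0.
  rewrite linear_sum (bigD1_ord i0)//= linearZ/= Fv scalerN scalerA.
  under eq_bigr do rewrite linearZ /=.
  rewrite addrC scaler_sumr -sumrB; apply: eq_bigr => i _.
  by rewrite scalerBl scalerA.
exists (\sum_(i < n) b i *: v (lift i0 i)).
  exists (fun k => if unlift i0 k is Some i then b i else 0).
  rewrite (bigD1_ord i0)//= unlift_none scale0r add0r.
  by apply: eq_bigr => i _; rewrite liftK.
by rewrite linear_sum; apply: eq_bigr => i _; rewrite linearZ.
Qed.

End FiniteDim.

(** * Bounded operators and finite dimensional subspaces of normed spaces *)

Section BoundedLinear.
Variables (K : numFieldType).

Lemma bounded_op_linear (V W : normedModType K) (S : {linear V -> W}) :
  bounded_op S -> bounded_linear S.
Proof.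
move=> /linear_boundedP bS; split; first exact: linearP.
have [C C0 SC] := pinfty_ex_gt0 bS.
by exists C => //; exact: ltW.
Qed.

Lemma bounded_linear_comp (U V W : normedModType K) (f : V -> W) (g : U -> V) :
  bounded_linear f -> bounded_linear g -> bounded_linear (f \o g).
Proof.
move=> [lf [C C0 fC]] [lg [D D0 gD]]; split=> [a x y|] /=; first by rewrite lg lf.
exists (C * D) => [|x]; first exact: mulr_ge0.
by apply: le_trans (fC _) _; rewrite -mulrA ler_wpM2l.
Qed.

Lemma bounded_linearB (V W : normedModType K) (f g : V -> W) :
  bounded_linear f -> bounded_linear g -> bounded_linear (fun x => f x - g x).
Proof.
move=> [lf [C C0 fC]] [lg [D D0 gD]]; split=> [a x y|] /=.
  by rewrite lg lf opprD addrACA scalerBr.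
exists (C + D) => [|x]; first exact: addr_ge0.
by rewrite mulrDl; apply: le_trans (ler_normB _ _) _; exact: lerD.
Qed.

Lemma bounded_linear_id (V : normedModType K) : bounded_linear (@id V).
Proof. by split=> //; exists 1 => // x; rewrite mul1r. Qed.

Lemma bounded_linear_sum (V W : normedModType K) n (f : 'I_n -> V -> K^o)
    (w : 'I_n -> W) : (forall i, bounded_linear (f i)) ->
  bounded_linear (fun x => \sum_(i < n) f i x *: w i).
Proof.
move=> bf; split=> [a x y|].
  rewrite scaler_sumr -big_split /=; apply: eq_bigr => i _.
  by rewrite (bf i).1 scalerDl scalerA.
have [i|C CP] := @choice _ _ (fun i c => 0 <= c /\ forall x, `|f i x| <= c * `|x|).
  by have [_ [c c0 fc]] := bf i; exists c.
exists (\sum_(i < n) C i * `|w i|) => [|x].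
  by apply: sumr_ge0 => i _; apply: mulr_ge0 => //; case: (CP i).
apply: le_trans (ler_norm_sum _ _ _) _; rewrite mulr_suml.
apply: ler_sum => i _; rewrite normrZ mulrAC ler_wpM2r//.
by case: (CP i).
Qed.

Lemma bounded_linear_is_continuous (V W : normedModType K) (f : V -> W) :
  bounded_linear f -> continuous f.
Proof.
move=> [/packed_linear[F <-] [C C0 FC]].
apply/linear_bounded_continuous/linear_boundedP.
near=> r => x; apply: le_trans (FC x) _; apply: ler_wpM2r => //.
by near: r; apply: nbhs_pinfty_ge; exact: ger0_real.
Unshelve. all: by end_near. Qed.

Lemma closed_equalizer (V W : normedModType K) (f g : V -> W) :
  bounded_linear f -> bounded_linear g -> closed [set x | f x = g x].
Proof.
move=> bf bg.
have -> : [set x | f x = g x] = (fun x => f x - g x) @^-1` [set 0].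
  apply/seteqP; split=> x /=; first by move=> ->; rewrite subrr.
  by move=> /eqP; rewrite subr_eq0 => /eqP.
apply: closed_comp => [x _|].
  exact: (bounded_linear_is_continuous (bounded_linearB bf bg)).
exact: (accessible_closed_set1 (hausdorff_accessible (@norm_hausdorff _ _))).
Qed.

Lemma bounded_linear0 (V W : normedModType K) : bounded_linear (fun _ : V => 0 : W).
Proof.
split=> [a x y|]; first by rewrite scaler0 addr0.
by exists 0 => // x; rewrite normr0 mul0r.
Qed.

Lemma closed_nullspace (V W : normedModType K) (f : V -> W) :
  bounded_linear f -> closed (nullspace f).
Proof. by move=> bf; apply: closed_equalizer => //; exact: bounded_linear0. Qed.

End BoundedLinear.

Section FiniteDimNormed.
Variables (K : numFieldType) (V : normedModType K).
Hypothesis sepV : points_separated V.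

(** The family need not be free: the functionals recover each [v j], which makes
the sum of the [f i x *: v i] a bounded projection onto the span.  A new vector [u]
is reduced modulo the projection [P] already found, and a functional that is 1 on
[u - P u] becomes one that vanishes on the old vectors after composition with
[1 - P]. *)
Lemma dual_family n (v : 'I_n -> V) : exists f : 'I_n -> V -> K^o,
  (forall i, bounded_linear (f i)) /\
  forall j, \sum_(i < n) f i (v j) *: v i = v j.
Proof.
elim: n v => [|n IH] v; first by exists (fun _ _ => 0); split=> -[].
pose w i := v (lift ord0 i); pose u := v ord0.
have [f [bf fw]] := IH w.
pose P x := \sum_(i < n) f i x *: w i.
have bP : bounded_linear P by exact: bounded_linear_sum.
have PP x : P (P x) = P x.
  have /packed_linear[F FE] := bP.1.
  rewrite -{1}FE {1}/P linear_sum /=; apply: eq_bigr => i _.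
  by rewrite linearZ FE /P fw.
have [g [bg gw gu]] : exists g : V -> K^o,
    [/\ bounded_linear g, forall i, g (w i) = 0 & u - P u = g u *: (u - P u)].
  have [->|u0] := eqVneq (u - P u) 0.
    by exists (fun=> 0); split=> //; [exact: bounded_linear0|rewrite scaler0].
  have [g bg gu] := sepV u0.
  exists (g \o (fun x => x - P x)); split.
  - apply: bounded_linear_comp => //; apply: bounded_linearB => //.
    exact: bounded_linear_id.
  - move=> i /=; rewrite [P _]fw subrr.
    by have /packed_linear[G <-] := bg.1; rewrite linear0.
  - by rewrite /= gu scale1r.
exists (fun k => if unlift ord0 k is Some i
  then fun x => f i x - f i u *: g x else g).
split=> [k|j].
  case: (unlift ord0 k) => [i|//].
  apply: bounded_linearB => //.
  have [lg [C C0 gC]] := bg; split=> [a x y|].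
    by rewrite lg scalerDr !scalerA mulrC.
  exists (`|f i u| * C) => [|x]; first exact: mulr_ge0.
  by rewrite normrZ -mulrA ler_wpM2l.
rewrite big_ord_recl unlift_none; under eq_bigr do rewrite liftK.
have [k ->|->] := unliftP ord0 j.
  rewrite -/(w k) gw scale0r add0r -[RHS]fw; apply: eq_bigr => i _.
  by rewrite scaler0 subr0.
rewrite -/u.
have gE i : f i u *: g u = g u * f i u by exact: mulrC.
under eq_bigr do rewrite scalerBl gE -scalerA.
rewrite sumrB -scaler_sumr -/(P u) addrCA -scalerBr -gu.
by rewrite addrC subrK.
Qed.

(** The bounded functionals of [dual_family] are combined with preimages of a spanning
family.  With [B = id] this is a projection onto [L]; with [R] a complement of the
kernel it bounds an inverse; and it produces the corrections of the tilde spaces. *)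
Lemma finite_dim_lift (U : normedModType K) (L : set V) (R : set U) (B : U -> V) :
  linear B -> linear_subspace R -> finite_dim L -> L `<=` B @` R ->
  exists f : V -> U, [/\ bounded_linear f, forall z, R (f z) &
    forall z, L z -> B (f z) = z].
Proof.
move=> /packed_linear[F <-] sR [n [v LE]] LB.
have [f [bf fv]] := dual_family v.
have Lv i : L (v i).
  rewrite LE; exists (fun j => (j == i)%:R).
  rewrite (bigD1 i)//= eqxx scale1r big1 ?addr0// => j /negPf ->.
  by rewrite scale0r.
have [i|r rP] := @choice _ _ (fun i x => R x /\ F x = v i).
  by have [x Rx Fx] := LB _ (Lv i); exists x.
exists (fun z => \sum_(i < n) f i z *: r i); split.
- exact: bounded_linear_sum.
- by move=> z; apply: subspace_sum => // i; case: (rP i).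
- have E z : F (\sum_(i < n) f i z *: r i) = \sum_(i < n) f i z *: v i.
    rewrite linear_sum; apply: eq_bigr => i _; rewrite linearZ /=.
    by case: (rP i) => _ ->.
  move=> z; rewrite E LE => -[a ->].
  have lP := (bounded_linear_sum v bf).1.
  have /packed_linear[P PE] := lP.
  rewrite -[LHS]/((fun x => \sum_(i < n) f i x *: v i) _) -PE linear_sum.
  by apply: eq_bigr => i _; rewrite linearZ /= PE fv.
Qed.

Lemma finite_dim_closed (A : set V) : finite_dim A -> closed A.
Proof.
move=> fA; have sA := finite_dim_subspace fA.
have [|P [bP PA AP]] := finite_dim_lift (bounded_linear_id V).1 sA fA.
  by move=> x Ax; exists x.
have -> : A = [set x | P x = x].
  by apply/seteqP; split=> x; [exact: AP|move=> /= <-].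
exact: closed_equalizer bP (bounded_linear_id _).
Qed.

End FiniteDimNormed.

Lemma finite_dim_bounded_below (K : numFieldType) (V W : normedModType K)
    (A : set V) (f : V -> W) : points_separated W ->
  linear f -> finite_dim A -> (forall x, A x -> f x = 0 -> x = 0) ->
  exists C : K, forall x, A x -> `|x| <= C * `|f x|.
Proof.
move=> sepW lf fA f0; have sA := finite_dim_subspace fA.
have [|g [[_ [C _ gC]] Ag gf]] := finite_dim_lift sepW lf sA (finite_dim_image lf fA).
  by [].
exists C => x Ax.
suff {1}<- : g (f x) = x by exact: gC.
apply/eqP; rewrite -subr_eq0; apply/eqP; apply: f0; first exact: subspaceB.
have fx : (f @` A) (f x) by exists x.
have := gf _ fx; have /packed_linear[F <-] := lf; rewrite linearB => ->.
by rewrite subrr.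
Qed.

(** * Complements adapted to the chains *)

(** [S' S] is a bounded projection with kernel [N(S)]; modulo [N(S)] the range of [T]
is finite dimensional, and a bounded projection [Q] onto its image under [S' S] is
split off. *)
Lemma complement_projection (K : numFieldType) (X Y : normedModType K)
    (S : {linear X -> Y}) (T : {linear Y -> X}) :
  points_separated X -> bounded_op S -> regular_op S ->
  finite_dim_quotient (range T) (nullspace S `&` range T) ->
  exists f : X -> X, [/\ bounded_linear f, forall x, f (f x) = f x &
    forall x, f x = 0 <-> exists2 r, range T r & S (x - r) = 0].
Proof.
move=> sepX bS [S' [bS' SS'S]] [n [w [Tw TE]]].
pose P x := S' (S x).
have bP : bounded_linear P.
  exact: bounded_linear_comp (bounded_op_linear bS') (bounded_op_linear bS).
have PP x : P (P x) = P x by rewrite /P SS'S.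
have PS x y : P x = P y <-> S (x - y) = 0.
  rewrite /P linearB; split=> [E|/eqP]; last by rewrite subr_eq0 => /eqP ->.
  by rewrite -[S x]SS'S E SS'S subrr.
pose U := P @` [set x | exists a : 'I_n -> K, x = \sum_(i < n) a i *: w i].
have fU : finite_dim U by apply: finite_dim_image bP.1 _; exists n, w.
have sU := finite_dim_subspace fU.
have [|Q [bQ QU UQ]] := finite_dim_lift sepX (bounded_linear_id X).1 sU fU.
  by move=> x Ux; exists x.
have PU x : U x -> P x = x by move=> [y _ <-]; exact: PP.
have PB x y : P (x - y) = P x - P y by rewrite /P !linearB.
have QB x y : Q (x - y) = Q x - Q y.
  by have /packed_linear[F <-] := bQ.1; rewrite linearB.
exists (fun x => P x - Q (P x)); split.
- by apply: bounded_linearB => //; exact: bounded_linear_comp.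
- move=> x; rewrite PB PP (PU _ (QU _)) QB (UQ _ (QU _)).
  by rewrite subrr subr0.
- move=> x; split=> [/eqP|[_ [y _ <-] /PS Px]].
    rewrite subr_eq0 => /eqP Px.
    have := QU (P x); rewrite -Px => -[_ [a ->] /esym /PS Sx].
    exists (\sum_(i < n) a i *: w i) => //.
    apply: subspace_sum => //; apply: subspace_image; first exact: linearP.
    exact: subspaceT.
  have TTy : range T (T y) by exists y.
  have [a [Sa _]] := TE _ TTy.
  have UPx : U (P x).
    rewrite Px; exists (\sum_(i < n) a i *: w i); first by exists a.
    by apply/esym/PS.
  by rewrite (UQ _ UPx) subrr.
Qed.

Lemma iter_bounded_linear (K : numFieldType) (W : normedModType K) (A : W -> W) n :
  bounded_linear A -> bounded_linear (iter n A).
Proof.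
move=> bA; elim: n => [|n IH]; first exact: bounded_linear_id.
exact: bounded_linear_comp bA IH.
Qed.

(** The correction of a complement: a point [x] whose image under [A ^ n] also comes
from [R] is moved by an element of [R] with the same image.  For a smaller exponent
the move is harmless: it changes the image by an element of [A ^ m (j R)], so an
[x] violating the condition afterwards would have violated it before. *)
Lemma straighten_projection (K : numFieldType) (X W : normedModType K)
    (A : W -> W) (j : X -> W) (R : set X) (f0 : X -> X) :
  points_separated W -> bounded_linear A -> bounded_linear j ->
  injective j -> linear_subspace R ->
  (forall n, finite_dim [set iter n.+1 A (j r) | r in R]) ->
  bounded_linear f0 -> (forall x, f0 (f0 x) = f0 x) -> R `<=` nullspace f0 ->
  forall k, exists f : X -> X, [/\ bounded_linear f, forall x, f (f x) = f x,
    forall x, f x = 0 <-> f0 x = 0 &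
    forall n x r, (n <= k)%N -> R r ->
      iter n A (j (f x)) = iter n A (j r) -> iter n A (j (f x)) = 0].
Proof.
move=> sepW bA bj jinj sR fdR bf0 f0f0 Rf0.
have [J JE] := packed_linear bj.1.
have iterL n : exists F : {linear W -> W}, iter n A = F.
  by have /packed_linear[F <-] := (iter_bounded_linear n bA).1; exists F.
elim=> [|k [f [bf ff kerf fk]]].
  exists f0; split=> // -[|//] x r _ Rr /= /jinj E.
  by rewrite -f0f0 E (Rf0 _ Rr) -JE linear0.
pose B x := iter k.+1 A (j x).
have bB : bounded_linear B := bounded_linear_comp (iter_bounded_linear k.+1 bA) bj.
have [//|g [bg Rg gB]] := finite_dim_lift sepW bB.1 sR (fdR k).
(* The values of [g] lie in [R], hence in the kernel of [f], for every [x]; this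
   keeps [f'] idempotent with the same kernel, whether or not [B (f x)] is in
   [B @` R]. *)
pose f' x := f x - g (B (f x)).
have [F FE] := packed_linear bf.1; have [G GE] := packed_linear bg.1.
have [B' BE] := packed_linear bB.1.
have fg x : f (g x) = 0 by apply/kerf; exact: Rf0.
have ff' x : f (f' x) = f x.
  by rewrite /f' -FE linearB FE ff fg subr0.
exists f'; split.
- apply: bounded_linearB => //; apply: bounded_linear_comp bg _.
  exact: bounded_linear_comp.
- by move=> x; rewrite {1}/f' ff'.
- move=> x; rewrite -kerf; split=> [E|E]; first by rewrite -ff' E -FE linear0.
  by rewrite /f' E -BE (linear0 B') -GE (linear0 G) subrr.
- move=> n x r nk Rr; have [In InE] := iterL n.
  rewrite InE /f' -JE !linearB JE -InE => E.
  have {}E : iter n A (j (f x)) = iter n A (j (r + g (B (f x)))).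
    rewrite InE -JE !linearD JE -InE; apply/eqP; rewrite -subr_eq; exact/eqP.
  have Rr' : R (r + g (B (f x))) by apply: subspaceD => //.
  move: nk; rewrite leq_eqVlt => /predU1P[nk|]; last first.
    rewrite ltnS => nk; have E0 := fk _ _ _ nk Rr' E.
    suff -> : B (f x) = 0 by rewrite -GE linear0 E0 -JE linear0 InE linear0 subrr.
    rewrite /B -(subnK (leqW nk)) iterD E0.
    by have [I ->] := iterL (k.+1 - n)%N; rewrite linear0.
  have -> : iter n A (j (g (B (f x)))) = B (f x).
    rewrite nk; apply: gB; rewrite /B -nk E; by exists (r + g (B (f x))).
  by rewrite nk subrr.
Qed.

Lemma iter_range_tilde (X Y : Type) (S : X -> Y) (T : Y -> X) n :
  iter_range S T n = tilde_range S T setT setT n.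
Proof.
suff : iter_range S T n = tilde_range S T setT setT n /\
  iter_range T S n = tilde_range T S setT setT n by case.
by elim: n => [//|n [IHS IHT]] /=; rewrite IHS IHT.
Qed.

Lemma finite_dim_second_range (K : numFieldType) (X Y : normedModType K)
    (S : {linear X -> Y}) (T : {linear Y -> X}) :
  finite_dim_quotient (range T) (nullspace S `&` range T) ->
  finite_dim (S @` range T).
Proof.
move=> [n [w [Tw TE]]].
pose U := [set x | exists a : 'I_n -> K, x = \sum_(i < n) a i *: w i].
apply: (@finite_dim_sub _ _ _ (S @` U)).
- apply: subspace_image; first exact: linearP.
  by apply: subspace_image => //; exact: linearP.
- by apply: finite_dim_image; [exact: linearP|exists n, w].
- move=> _ [r Tr <-]; have [a [Sa _]] := TE r Tr.
  exists (\sum_(i < n) a i *: w i); first by exists a.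
  by apply/esym/eqP; rewrite -subr_eq0 -linearB; exact/eqP.
Qed.

Section Chains.
Variables (K : numFieldType) (X Y : normedModType K).
Variables (S : {linear X -> Y}) (T : {linear Y -> X}).

(** The alternating compositions of [S] and [T] become powers of one operator on the
product, which spares a distinction between exponents of either parity. *)
Definition pair_step (z : X * Y) : X * Y := (T z.2, S z.1).

Lemma pair_step_bounded : bounded_op S -> bounded_op T ->
  bounded_linear pair_step.
Proof.
move=> /bounded_op_linear[lS [C C0 SC]] /bounded_op_linear[lT [D D0 TD]].
split=> [a [x y] [x' y']|].
  by rewrite /pair_step /= !linearP.
exists (C + D) => [|[x y]]; first exact: addr_ge0.
rewrite /pair_step /= !prod_normE /= num_ge_max /=; apply/andP; split.
- apply: le_trans (TD _) _; apply: ler_pM => //; first by rewrite lerDr.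
  by rewrite num_le_max /= lexx orbT.
- apply: le_trans (SC _) _; apply: ler_pM => //; first by rewrite lerDl.
  by rewrite num_le_max /= lexx.
Qed.

Lemma pair_step_linear : linear pair_step.
Proof. by move=> a [x y] [x' y']; rewrite /pair_step /= !linearP. Qed.

Lemma iter_pair_step_linear n : linear (iter n pair_step).
Proof.
elim: n => [//|n IH] a u v; by rewrite !iterS IH pair_step_linear.
Qed.

Lemma iter_pair_stepD n (x : X) (y : Y) :
  iter n pair_step (x, y) = iter n pair_step (x, 0) + iter n pair_step (0, y).
Proof.
have /packed_linear[F <-] := iter_pair_step_linear n.
rewrite -linearD; congr (F _).
by apply: injective_projections; rewrite /= ?addr0 ?add0r.
Qed.

Lemma iter_pair_step_left n (x : X) :
  if odd n then (iter n pair_step (x, 0)).1 = 0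
  else (iter n pair_step (x, 0)).2 = 0.
Proof.
elim: n => [//|n]; rewrite iterS [odd n.+1]/=; move: (iter n _ _) => z.
by case: (odd n); rewrite /pair_step /= => ->; rewrite linear0.
Qed.

Lemma iter_pair_step_right n (y : Y) :
  if odd n then (iter n pair_step (0, y)).2 = 0
  else (iter n pair_step (0, y)).1 = 0.
Proof.
elim: n => [//|n]; rewrite iterS [odd n.+1]/=; move: (iter n _ _) => z.
by case: (odd n); rewrite /pair_step /= => ->; rewrite linear0.
Qed.

Lemma tilde_range_iter (Xt : set X) (Yt : set Y) n : Xt 0 -> Yt 0 ->
  tilde_range S T Xt Yt n = [set (iter n pair_step z).2 | z in Xt `*` Yt] /\
  tilde_range T S Yt Xt n = [set (iter n pair_step z).1 | z in Xt `*` Yt].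
Proof.
move=> Xt0 Yt0; elim: n => [|n [IHS IHT]] /=.
  split; apply/seteqP; split=> [x Xx|_ [[x y] [/= Xx Yy] <-]] //.
    by exists (0, x).
  by exists (x, 0).
by rewrite IHS IHT !image_comp.
Qed.

End Chains.

(** Directness of the sums R_n = R_{n+1} + R_{~n} up to [k], read on the chains that
start in [X]: a chain from [Xt] that falls into the next range ends there. *)
Definition straight (K : numFieldType) (X Y : normedModType K)
    (S : {linear X -> Y}) (T : {linear Y -> X}) (Xt : set X) (k : nat) : Prop :=
  forall n x r, (n <= k)%N -> Xt x -> range T r ->
    iter n (pair_step S T) (x, 0) = iter n (pair_step S T) (r, 0) ->
    iter n (pair_step S T) (x, 0) = 0.

Lemma iter_pair_step_swap (K : numFieldType) (X Y : normedModType K)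
    (S : {linear X -> Y}) (T : {linear Y -> X}) n (x : X) (y : Y) :
  iter n (pair_step T S) (y, x) =
  ((iter n (pair_step S T) (x, y)).2, (iter n (pair_step S T) (x, y)).1).
Proof. by elim: n => [//|n IH]; rewrite !iterS IH. Qed.

(** An element of the tilde range in [Y] comes from [Xt] or from [Yt] according to the
parity of [n]; the assumption on that space applies. *)
Lemma straight_inter (K : numFieldType) (X Y : normedModType K)
    (S : {linear X -> Y}) (T : {linear Y -> X}) (Xt : set X) (Yt : set Y) k :
  Xt 0 -> Yt 0 -> straight S T Xt k -> straight T S Yt k ->
  forall n v, (n <= k)%N -> tilde_range S T Xt Yt n v ->
    iter_range S T n.+1 v -> v = 0.
Proof.
move=> Xt0 Yt0 stX stY n v nk.
have [-> _] := tilde_range_iter S T n Xt0 Yt0.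
rewrite iter_range_tilde.
have [-> _] := @tilde_range_iter _ _ _ S T setT setT n.+1 I I.
move=> [[x y] XY <-] [[y' x'] _]; move: XY => [Xx Yy]; rewrite iterSr.
have -> : pair_step S T (y', x') = (T x', S y') by [].
set r := T _; set s := S _.
have Tr : range T r by exists x'.
have Ss : range S s by exists y'.
rewrite (iter_pair_stepD S T n x y) (iter_pair_stepD S T n r s).
move: (iter_pair_step_left S T n x) (iter_pair_step_left S T n r).
move: (iter_pair_step_right S T n y) (iter_pair_step_right S T n s).
case: (odd n) => /= y0 s0 x0 r0.
  rewrite y0 s0 !addr0 => E.
  by rewrite (stX n x r nk Xx Tr) //; apply: injective_projections; rewrite ?x0 ?r0.
rewrite x0 r0 !add0r => E.
have Es : iter n (pair_step T S) (y, 0) = iter n (pair_step T S) (s, 0).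
  by rewrite !(iter_pair_step_swap S T) y0 s0 E.
have := congr1 fst (stY n y s nk Yy Ss Es).
by rewrite (iter_pair_step_swap S T).
Qed.

(** The abstract correction applied to the chains starting in [X].  The spaces
[A ^ n.+1 (range T, 0)] are finite dimensional as images of [S (range T)]. *)
Lemma straight_complement (K : numFieldType) (hK : real_or_complex K)
    (X Y : normedModType K) (S : {linear X -> Y}) (T : {linear Y -> X}) k :
  bounded_op S -> bounded_op T -> regular_op S ->
  finite_dim_quotient (range T) (nullspace S `&` range T) ->
  exists f : X -> X, [/\ bounded_linear f, forall x, f (f x) = f x,
    forall x, f x = 0 <-> exists2 r, range T r & S (x - r) = 0 &
    straight S T (range f) k].
Proof.
move=> bS bT rS qT; have sepX := banach_points_separated (V := X) hK.
have [f0 [bf0 f0f0 kerf0]] := complement_projection sepX bS rS qT.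
have sT : linear_subspace (range T).
  by apply: subspace_image => //; exact: linearP.
pose j (x : X) : X * Y := (x, 0).
have bj : bounded_linear j.
  split=> [a x y|].
    by apply: injective_projections; rewrite /= ?scaler0 ?addr0.
  exists 1 => // x; rewrite mul1r prod_normE /= num_ge_max /=.
  by rewrite lexx normr0 normr_ge0.
have ij : injective j by move=> x y [].
have fd n : finite_dim [set iter n.+1 (pair_step S T) (j r) | r in range T].
  elim: n => [|n IH].
    have -> : [set iter 1 (pair_step S T) (j r) | r in range T] =
        (fun y => (0, y)) @` (S @` range T).
      rewrite [RHS]image_comp; apply: eq_imagel => r _.
      by rewrite /= /pair_step /= linear0.
    apply: finite_dim_image (finite_dim_second_range qT) => a x y.
    by apply: injective_projections; rewrite /= ?scaler0 ?addr0.
  have -> : [set iter n.+2 (pair_step S T) (j r) | r in range T] =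
      pair_step S T @` [set iter n.+1 (pair_step S T) (j r) | r in range T].
    by rewrite [RHS]image_comp.
  by apply: finite_dim_image IH; exact: pair_step_linear.
have Rf0 : range T `<=` nullspace f0.
  by move=> r Tr; apply/kerf0; exists r => //; rewrite subrr linear0.
have [f [bf ff kerf fk]] := straighten_projection
  (banach_points_separated (V := (X * Y)%type) hK)
  (pair_step_bounded bS bT) bj ij sT fd bf0 f0f0 Rf0 k.
exists f; split=> //.
- by move=> x; rewrite kerf; exact: kerf0.
- by move=> n _ r nk [x _ <-]; exact: fk.
Qed.

(** * The splitting of the ranges *)

Section TildeRanges.
Variables (K : numFieldType) (X Y : lmodType K).
Variables (S : {linear X -> Y}) (T : {linear Y -> X}).

Lemma tilde_range_subspace (Xt : set X) (Yt : set Y) n :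
  linear_subspace Xt -> linear_subspace Yt ->
  linear_subspace (tilde_range S T Xt Yt n).
Proof.
move=> sX sY; suff : linear_subspace (tilde_range S T Xt Yt n) /\
  linear_subspace (tilde_range T S Yt Xt n) by case.
elim: n => [//|n [IHS IHT]] /=.
by split; apply: subspace_image => //; exact: linearP.
Qed.

Lemma iter_range_subspace n : linear_subspace (iter_range S T n).
Proof. by rewrite iter_range_tilde; apply: tilde_range_subspace. Qed.

Lemma tilde_range_sub (Xt : set X) (Yt : set Y) n :
  tilde_range S T Xt Yt n `<=` iter_range S T n.
Proof.
suff : tilde_range S T Xt Yt n `<=` iter_range S T n /\
  tilde_range T S Yt Xt n `<=` iter_range T S n by case.
elim: n => [//|n [IHS IHT]] /=; split; exact: image_subset.
Qed.

Lemma iter_range_decr n : iter_range S T n.+1 `<=` iter_range S T n.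
Proof.
suff : iter_range S T n.+1 `<=` iter_range S T n /\
  iter_range T S n.+1 `<=` iter_range T S n by case.
elim: n => [//|n [IHS IHT]]; split; apply: image_subset; [exact: IHT|exact: IHS].
Qed.

Lemma iter_range_le m n : (m <= n)%N -> iter_range S T n `<=` iter_range S T m.
Proof.
move=> mn; rewrite -(subnK mn); elim: (n - m)%N => [//|k IH].
by rewrite addSn; apply: subset_trans IH; exact: iter_range_decr.
Qed.

End TildeRanges.

(** The good complements of [N(S) + R(T)]: the first two clauses say, without forming
the sum, that [Xt] is a complement; the third is what makes the sums of an adapted
system direct in [Y]; the last two describe the stable range in [Y]. *)
Definition chain_complement (K : numFieldType) (X Y : lmodType K)
    (S : {linear X -> Y}) (T : {linear Y -> X}) (Xt : set X) (Yt : set Y)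
    (p : nat) : Prop :=
  linear_subspace Xt /\
  [/\ forall x, exists r t, [/\ range T r, Xt t & S (x - (r + t)) = 0],
      forall t r, Xt t -> range T r -> S (t - r) = 0 -> t = 0,
      forall n v, tilde_range S T Xt Yt n v -> iter_range S T n.+1 v -> v = 0,
      forall n, (p <= n)%N -> iter_range S T n = iter_range S T p &
      forall y, iter_range S T p y -> T y = 0 -> y = 0].

Section AdaptedHalf.
Variables (K : numFieldType) (X Y : lmodType K).
Variables (S : {linear X -> Y}) (T : {linear Y -> X}).
Variables (Xt : set X) (Yt : set Y) (p : nat).
Hypotheses (chS : chain_complement S T Xt Yt p) (chT : chain_complement T S Yt Xt p).

Lemma iter_range_split n v : iter_range S T n.+1 v ->
  exists r t, [/\ iter_range S T n.+2 r, tilde_range S T Xt Yt n.+1 t & r + t = v].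
Proof.
have [sXt [decX _ _ _ _]] := chS; have [sYt [decY _ _ _ _]] := chT.
suff : (forall v, iter_range S T n.+1 v -> exists r t,
    [/\ iter_range S T n.+2 r, tilde_range S T Xt Yt n.+1 t & r + t = v]) /\
  (forall v, iter_range T S n.+1 v -> exists r t,
    [/\ iter_range T S n.+2 r, tilde_range T S Yt Xt n.+1 t & r + t = v]).
  by case=> h _; exact: h.
elim: n {v} => [|n [IHS IHT]].
  split=> _ [x _ <-].
    have [r [t [Tr Xtt /eqP]]] := decX x; rewrite linearB subr_eq0 => /eqP ->.
    by exists (S r), (S t); rewrite linearD; split=> //; [exists r|exists t].
  have [r [t [Tr Xtt /eqP]]] := decY x; rewrite linearB subr_eq0 => /eqP ->.
  by exists (T r), (T t); rewrite linearD; split=> //; [exists r|exists t].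
split=> _ [x Rx <-].
  have [r [t [Rr Rt <-]]] := IHT x Rx.
  by exists (S r), (S t); rewrite linearD; split=> //; [exists r|exists t].
have [r [t [Rr Rt <-]]] := IHS x Rx.
by exists (T r), (T t); rewrite linearD; split=> //; [exists r|exists t].
Qed.

Lemma tilde_range_stable n v : (p <= n)%N ->
  tilde_range S T Xt Yt n v -> v = 0.
Proof.
have [_ [_ _ sep stab _]] := chS.
move=> pn tv; apply: (sep n v tv).
by rewrite stab ?(leqW pn)// -(stab n pn); exact: (@tilde_range_sub _ _ _ _ _ Xt Yt).
Qed.

End AdaptedHalf.

Definition splits (K : numFieldType) (X Y : lmodType K) (S : X -> Y)
    (E A : set X) : Prop :=
  forall v, A v -> exists a b, [/\ A a, S a = 0, A b, E b & a + b = v].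

Lemma splits_direct_sum (K : numFieldType) (X Y : lmodType K)
    (S : {linear X -> Y}) (E A : set X) :
  linear_subspace E -> linear_subspace A ->
  (forall x, E x -> S x = 0 -> x = 0) -> splits S E A ->
  direct_sum A [:: A `&` nullspace S; A `&` E].
Proof.
move=> sE sA E0 SA; apply: direct_sum2I => //.
- by apply: subspaceI => //; apply: subspace_nullspace; exact: linearP.
- exact: subspaceI.
- by move=> x /SA[a [b [Aa Sa Ab Eb <-]]]; exists a, b.
- by move=> x [_ Sx] [_ Ex]; exact: E0.
Qed.

(** The properties that make [E] a possible [X_2] of an adapted system. *)
Definition splitting_space (K : numFieldType) (X Y : lmodType K)
    (S : X -> Y) (T : Y -> X) (Xt : set X) (Yt : set Y) (E : set X) : Prop :=
  [/\ linear_subspace E, E `<=` range T, finite_dim E,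
    forall x, E x -> S x = 0 -> x = 0 &
    forall m, (1 <= m)%N -> splits S E (iter_range T S m) /\
      splits S E (tilde_range T S Yt Xt m)].

(** The induction goes down from the stable range.  A complement [D] of the kernel in
the tilde range of level [n] is added to the space [E] of level [n + 1].  The sum
still avoids the kernel: from [S (e + d) = 0] the vector [S d] lies both in a tilde
range and in the next range, so [S d = 0]. *)
Lemma exists_splitting_space (K : numFieldType) (X Y : normedModType K)
    (S : {linear X -> Y}) (T : {linear Y -> X}) (Xt : set X) (Yt : set Y) p :
  chain_complement S T Xt Yt p -> chain_complement T S Yt Xt p -> (0 < p)%N ->
  finite_dim_quotient (range T) (nullspace S `&` range T) ->
  exists E : set X, splitting_space S T Xt Yt E.
Proof.
move=> chS chT p0 [d [w [_ Tw]]].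
have Tw' x : range T x ->
    exists a : 'I_d -> K, nullspace S (x - \sum_(i < d) a i *: w i).
  by move=> /Tw[a [Sa _]]; exists a.
have sN : linear_subspace (nullspace S).
  by apply: subspace_nullspace; exact: linearP.
have [sXt [_ _ sepS _ _]] := chS.
have [sYt [_ _ _ stabT injS]] := chT.
have zero_split (E A : set X) : linear_subspace E -> linear_subspace A ->
    (forall v, A v -> v = 0) -> splits S E A.
  move=> sE sA A0 v /A0 ->; exists 0, 0; rewrite linear0 addr0.
  by split=> //; [exact: sA.1|exact: sA.1|exact: sE.1].
have stR m := @iter_range_subspace _ _ _ T S m.
have stt m : linear_subspace (tilde_range T S Yt Xt m).
  exact: tilde_range_subspace.
(* At step [k] all levels from [p - k] on are split; [k = p - 1] is the claim. *)
suff /(_ p.-1) : forall k, (k < p)%N -> exists E : set X, [/\ linear_subspace E,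
    E `<=` iter_range T S (p - k), forall x, E x -> S x = 0 -> x = 0 &
    forall m, (p - k <= m)%N -> splits S E (iter_range T S m) /\
      splits S E (tilde_range T S Yt Xt m)].
  rewrite -subn1 subKn// subn1 ltn_predL => /(_ p0)[E [sE ET E0 sp]].
  exists E; split=> //.
  apply: (finite_dim_inter0 (v := w) sE sN) => // x Ex; apply: Tw'.
  exact: ET.
elim=> [_|k IH kp].
  rewrite subn0; exists (iter_range T S p); split=> // m pm; split.
    move=> v; rewrite stabT// => Rv; exists 0, v; rewrite linear0 add0r.
    by split=> //; exact: (stR p).1.
  apply: zero_split => // v; exact: (tilde_range_stable chT).
have [E [sE ER E0 sp]] := IH (ltnW kp).
have [n nE] : exists n, (p - k.+1)%N = n.+1.
  by exists (p - k.+1).-1; rewrite prednK// subn_gt0.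
have nE' : (p - k)%N = n.+2 by rewrite -nE subnS prednK // subn_gt0 ltnW.
rewrite nE' in ER sp; rewrite nE.
have tT : tilde_range T S Yt Xt n.+1 `<=` range T.
  apply: subset_trans (@tilde_range_sub _ _ _ _ _ Yt Xt n.+1) _.
  exact: (iter_range_le (m := 1)).
have [D [fD Dt dD]] :=
  finite_dim_complement (stt n.+1) sN (fun x tx => Tw' x (tT x tx)).
have [_ tE DN] := direct_sum2E dD.
have sD := finite_dim_subspace fD.
pose E' := [set x | exists e d, [/\ E e, D d & e + d = x]].
have EE' : E `<=` E'.
  by move=> x Ex; exists x, 0; rewrite addr0; split=> //; exact: sD.1.
have DE' : D `<=` E'.
  by move=> x Dx; exists 0, x; rewrite add0r; split=> //; exact: sE.1.
have tR : tilde_range T S Yt Xt n.+1 `<=` iter_range T S n.+1.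
  exact: (@tilde_range_sub _ _ _ _ _ Yt Xt n.+1).
exists E'; split.
- split; first exact: EE' sE.1.
  move=> a _ _ [e [f [Ee Df <-]]] [e' [f' [Ee' Df' <-]]].
  exists (a *: e + e'), (a *: f + f'); rewrite scalerDr addrACA.
  by split=> //; [exact: sE.2|exact: sD.2].
- move=> _ [e [f [/ER Re /Dt tf <-]]]; apply: subspaceD; first exact: stR.
    exact: (iter_range_decr Re).
  exact: tR.
- move=> _ [e [f [Ee Df <-]]] /eqP; rewrite linearD addr_eq0 => /eqP Sef.
  have Sf : S f = 0.
    apply: (sepS n.+2); first by exists f => //; exact: Dt.
    rewrite -[S f]opprK -Sef; apply: subspaceN; first exact: iter_range_subspace.
    by exists e => //; exact: ER.
  have -> : f = 0 by apply: DN => //; split=> //; exact: Dt.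
  by rewrite addr0; apply: E0 => //; rewrite Sef Sf oppr0.
- have E'sub A : splits S E A -> splits S E' A.
    move=> sA v /sA[a [b [Aa Sa Ab Eb ab]]]; exists a, b; split=> //; exact: EE'.
  move=> m; rewrite leq_eqVlt => /predU1P[<-|nm]; last first.
    by have [sp1 sp2] := sp m nm; split; exact: E'sub.
  split=> [v /(iter_range_split chT chS)[r [t [Rr tt <-]]]|v /tE].
    have [a [b [Ra Sa Rb Eb <-]]] := (sp n.+2 (leqnn _)).1 r Rr.
    have [c [f [[tc Sc] Df <-]]] := tE t tt.
    exists (a + c), (b + f); rewrite addrACA linearD Sa Sc addr0; split=> //.
    + by apply: subspaceD => //; [exact: iter_range_decr|exact: tR].
    + by apply: subspaceD => //; [exact: iter_range_decr|exact: tR (Dt _ Df)].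
    + by exists b, f.
  move=> [c [f [[tc Sc] Df <-]]]; exists c, f; split=> //; first exact: Dt.
  exact: DE'.
Qed.

(** * Direct sums along the chains *)

Section HalfFacts.
Variables (K : numFieldType) (X Y : lmodType K).
Variables (S : {linear X -> Y}) (T : {linear Y -> X}).
Variables (Xt : set X) (Yt : set Y) (p : nat) (E : set X) (F : set Y).
Hypotheses (chS : chain_complement S T Xt Yt p) (chT : chain_complement T S Yt Xt p).
Hypotheses (spE : splitting_space S T Xt Yt E) (spF : splitting_space T S Yt Xt F).

Let R n := iter_range T S n.
Let t n := tilde_range T S Yt Xt n.

Let sR n : linear_subspace (R n).
Proof. exact: iter_range_subspace. Qed.

Let st n : linear_subspace (t n).
Proof. by apply: tilde_range_subspace; [case: chT|case: chS]. Qed.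

Let sN : linear_subspace (nullspace S).
Proof. by apply: subspace_nullspace; exact: linearP. Qed.

Let sE : linear_subspace E.
Proof. by case: spE. Qed.

Let tR n : t n `<=` R n.
Proof. exact: tilde_range_sub. Qed.

Lemma direct_sum_range n : (1 <= n)%N ->
  direct_sum (R n) [:: R n `&` nullspace S; R n `&` E].
Proof.
have [_ _ _ E0 sp] := spE => n1.
by apply: splits_direct_sum => //; exact: (sp n n1).1.
Qed.

Lemma direct_sum_tilde n : (1 <= n)%N ->
  direct_sum (t n) [:: t n `&` nullspace S; t n `&` (R n `&` E)].
Proof.
have [_ _ _ E0 sp] := spE => n1.
have -> : t n `&` (R n `&` E) = t n `&` E.
  by rewrite setIA (setIidl (@tR n)).
by apply: splits_direct_sum => //; exact: (sp n n1).2.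
Qed.

Lemma direct_sum_step n : (1 <= n)%N -> direct_sum (R n) [:: R n.+1; t n].
Proof.
case: n => // n _; have [_ [_ _ sep _ _]] := chT.
apply: direct_sum2I; [exact: sR|exact: sR|exact: st|
  exact: iter_range_decr|exact: tR| |].
- by move=> v /(iter_range_split chT chS)[r [s [Rr ts <-]]]; exists r, s.
- by move=> v Rv tv; exact: sep tv Rv.
Qed.

(** If [S (r + s) = 0], then [S s] is in a tilde range and in the next range, so the
two parts lie in the kernel separately. *)
Lemma direct_sum_kernel n : (1 <= n)%N ->
  direct_sum (R n `&` nullspace S) [:: t n `&` nullspace S; R n.+1 `&` nullspace S].
Proof.
move=> n1.
have [_ [_ _ sepS _ _]] := chS.
have [_ RE Rt] := direct_sum2E (direct_sum_step n1).
apply: direct_sum2I; try exact: subspaceI.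
- by move=> v [tv Sv]; split=> //; exact: tR.
- by move=> v [Rv Sv]; split=> //; exact: iter_range_decr.
- move=> v [/RE[r [s [Rr ts <-]]]] /eqP; rewrite linearD addr_eq0 => /eqP Sr.
  have Ss : S s = 0.
    apply: (sepS n.+1); first by exists s.
    rewrite -[S s]opprK -Sr; apply: subspaceN; first exact: iter_range_subspace.
    by exists r.
  exists s, r; rewrite addrC; split=> //; split=> //.
  by rewrite /nullspace /= Sr Ss oppr0.
- by move=> v [tv _] [Rv _]; exact: Rt.
Qed.

(** The kernel parts of the two components of [v] in [E] add up to an element of [E]
in the kernel, so they cancel. *)
Lemma direct_sum_splitting n : (1 <= n)%N ->
  direct_sum (R n `&` E) [:: R n.+1 `&` E; t n `&` (R n `&` E)].
Proof.
move=> n1; have [_ _ _ E0 sp] := spE.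
have [_ RE Rt] := direct_sum2E (direct_sum_step n1).
have sRE m : linear_subspace (R m `&` E) by exact: subspaceI.
apply: direct_sum2I => //; first exact: subspaceI.
  by move=> v [Rv Ev]; split=> //; exact: iter_range_decr.
- move=> v [Rv Ev]; have [r [s [Rr ts rs]]] := RE v Rv.
  have [r1 [r2 [_ Sr1 Rr2 Er2 r12]]] := (sp n.+1 isT).1 r Rr.
  have [s1 [s2 [_ Ss1 ts2 Es2 s12]]] := (sp n n1).2 s ts.
  have E1 : v - (r2 + s2) = r1 + s1.
    by rewrite -rs -r12 -s12 addrACA addrK.
  have v0 : v - (r2 + s2) = 0.
    apply: E0; last by rewrite E1 linearD Sr1 Ss1 addr0.
    by apply: subspaceB => //; exact: subspaceD.
  exists r2, s2; split=> //; first by split=> //; split=> //; exact: tR.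
  by apply/esym/eqP; rewrite -subr_eq0 v0.
- by move=> v [Rv _] [tv _]; exact: Rt.
Qed.

Lemma image_splitting_tilde n : (1 <= n)%N ->
  S @` (t n `&` (R n `&` E)) = tilde_range S T Xt Yt n.+1.
Proof.
move=> n1; have [_ _ _ _ sp] := spE; apply/seteqP; split.
  by move=> _ [x [tx _] <-]; exists x.
move=> _ [x tx <-]; have [a [b [ta Sa tb Eb <-]]] := (sp n n1).2 x tx.
exists b; last by rewrite linearD Sa add0r.
by split=> //; split=> //; exact: tR.
Qed.

Lemma splitting_tilde_last n x : (p <= n.+1)%N -> (t n `&` (R n `&` E)) x -> x = 0.
Proof.
have [_ _ _ E0 _] := spE => pn [tx [_ Ex]]; apply: E0 => //.
by apply: (tilde_range_stable chS pn); exists x.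
Qed.

Lemma splitting_last : (1 <= p)%N -> R p.-1 `&` E `<=` R p.
Proof.
move=> p1; have [_ ET _ E0 sp] := spE.
have [p2|p2] := leqP 2 p; last first.
  have -> : p = 1%N by apply/eqP; rewrite eqn_leq p1 andbT.
  by move=> x [_ /ET].
have pK : p.-1.+1 = p by exact: prednK.
have p11 : (1 <= p.-1)%N by rewrite -ltnS pK.
have [_ RE _] := direct_sum2E (direct_sum_splitting p11).
move=> x /RE[r [s [[Rr _] ts <-]]]; rewrite pK in Rr.
by rewrite (splitting_tilde_last _ ts) ?pK// addr0.
Qed.

Lemma range_sub_splitting : (1 <= p)%N -> R p `<=` E.
Proof.
move=> p1 x Rx; have [_ _ _ _ sp] := spE; have [_ [_ _ _ _ inj]] := chT.
have [a [b [Ra Sa _ Eb <-]]] := (sp p p1).1 x Rx.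
by rewrite (inj a Ra Sa) add0r.
Qed.

Lemma image_splitting_last : (2 <= p)%N ->
  S @` (R p.-1 `&` E) = iter_range S T p.
Proof.
move=> p2; have pK : p.-1.+1 = p by rewrite prednK// ltnW.
have [_ _ _ _ sp] := spE; apply/seteqP; split=> [_ [x [Rx _] <-]|].
  by rewrite -pK; exists x.
rewrite -[in iter_range _ _ p]pK => _ [x Rx <-].
have p11 : (1 <= p.-1)%N by rewrite -ltnS pK.
have [a [b [Ra Sa Rb Eb <-]]] := (sp p.-1 p11).1 x Rx.
by exists b => //; rewrite linearD Sa add0r.
Qed.

Lemma injective_tilde x : Xt x -> S x = 0 -> x = 0.
Proof.
move=> Xx Sx; have [_ [_ indep _ _ _]] := chS.
apply: (indep x 0) => //; last by rewrite subr0.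
by exists 0 => //; rewrite linear0.
Qed.

Lemma direct_sum_complement :
  direct_sum setT [:: nullspace S; sums [:: E; Xt]] /\
  direct_sum (sums [:: E; Xt]) [:: E; Xt].
Proof.
have [_ ET _ E0 sp] := spE; have [sXt [dec indep _ _ _]] := chS.
have sEX : linear_subspace (sums [:: E; Xt]).
  by apply: subspace_sums; do 2 constructor=> //.
have EXI b c : E b -> Xt c -> sums [:: E; Xt] (b + c).
  move=> Eb Xc; exists b => //; exists c => //; exists c => //.
  by exists 0 => //; rewrite addr0.
have EXE x : sums [:: E; Xt] x -> exists b c, [/\ E b, Xt c & b + c = x].
  by move=> [b Eb [_ [c Cc [_ -> <-]] <-]]; exists b, c; rewrite addr0.
split; apply: direct_sum2I => //.
- move=> x _; have [r [s [Tr Xs Sx]]] := dec x.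
  have [a [b [_ Sa _ Eb ab]]] := (sp 1%N isT).1 r Tr.
  exists (x - (r + s) + a), (b + s); split.
  + by apply: (subspaceD sN).
  + exact: EXI.
  + by rewrite -addrA [a + _]addrA ab subrK.
- move=> x Sx /EXE[b [c [Eb Xc bc]]].
  have c0 : c = 0.
    apply: (indep c (- b)) => //.
      by apply: ET; exact: subspaceN.
    by rewrite opprK addrC bc.
  move: bc; rewrite c0 addr0 => bx; rewrite -bx; apply: E0 => //.
  by rewrite bx.
- by move=> x Ex; rewrite -[x]addr0; apply: EXI => //; exact: sXt.1.
- by move=> x Xx; rewrite -[x]add0r; apply: EXI => //; exact: sE.1.
- move=> x Ex Xx; apply: (indep x x) => //; first exact: ET.
  by rewrite subrr linear0.
Qed.

Lemma direct_sum_kernel_chain k n : (1 <= n)%N -> (p <= n + k)%N ->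
  direct_sum (R n `&` nullspace S) [seq t i `&` nullspace S | i <- iota n k].
Proof.
elim: k n => [|k IH] n n1 pnk /=.
  have [_ [_ _ _ stab inj]] := chT.
  rewrite addn0 in pnk; split=> //; apply/seteqP; split=> [x [Rx Sx]|_ ->].
    by apply: inj => //; rewrite -(stab n pnk).
  by split; [exact: (sR n).1|exact: sN.1].
apply: direct_sum_cons (direct_sum_kernel n1) _.
by apply: IH => //; rewrite addSnnS.
Qed.

(** The stable summand is kept in front, where the final decomposition has it. *)
Lemma direct_sum_splitting_chain k n : (1 <= n)%N ->
  direct_sum (R n `&` E) (R (n + k)%N `&` E ::
    [seq t i `&` (R i `&` E) | i <- iota n k]).
Proof.
elim: k n => [|k IH] n n1 /=.
  have sRE : linear_subspace (R n `&` E) by exact: subspaceI (sR n) sE.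
  rewrite addn0; split=> /=.
    apply/seteqP; split=> [x Rx|_ [x Rx [_ -> <-]]]; last by rewrite addr0.
    by exists x => //; exists 0 => //; rewrite addr0.
  split=> //; apply/seteqP; split=> [x []//|_ ->].
  by split=> //; exact: sRE.1.
have stE i : linear_subspace (t i `&` (R i `&` E)).
  apply: subspaceI; first exact: st.
  by apply: subspaceI => //; exact: sR.
apply: direct_sum_swap => //.
- by apply: subspaceI => //; exact: sR.
- apply: subspace_sums; elim: k n.+1 {IH n1} => [|k IH] m /=; constructor=> //.
- rewrite addnS -addSn; apply: direct_sum_cons; last exact: IH.
  have [BCA AE BC] := direct_sum2E (direct_sum_splitting n1).
  apply: direct_sum2I.
  + by apply: subspaceI => //; exact: sR.
  + exact: stE.
  + by apply: subspaceI => //; exact: sR.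
  + by move=> x [_ []].
  + by move=> x [Rx Ex]; split=> //; exact: iter_range_decr.
  + by move=> x /AE[b [c [Bb Cc <-]]]; exists c, b; rewrite addrC.
  + by move=> x Cx Bx; exact: BC.
Qed.

End HalfFacts.

(** * The decomposition and the action of the operator *)

Lemma banach_isoI (K : numFieldType) (X Y : completeNormedModType K)
    (S : {linear X -> Y}) (A : set X) (B : set Y) :
  bounded_op S -> linear_subspace A -> closed A -> closed B -> S @` A = B ->
  (exists C : K, forall x, A x -> `|x| <= C * `|S x|) -> banach_iso S A B.
Proof.
move=> bS sA cA cB SAB [C AC]; have [_ [D _ SD]] := bounded_op_linear bS.
split=> //.
- by split=> //; rewrite -SAB; apply: subspace_image => //; exact: linearP.
- split.
  + by move=> x Ax; rewrite -SAB; exists x.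
  + move=> x y /set_mem Ax /set_mem Ay Sxy.
    have := AC (x - y) (subspaceB sA Ax Ay).
    by rewrite linearB Sxy subrr normr0 mulr0 normr_le0 subr_eq0 => /eqP.
  + by move=> y; rewrite -SAB => -[x Ax <-]; exists x.
- by exists D => x _; exact: SD.
- by exists C.
Qed.

Section HalfConclusions.
Variables (K : numFieldType) (X Y : completeNormedModType K).
Variables (S : {linear X -> Y}) (T : {linear Y -> X}).
Variables (D : decomp_data X Y) (p : nat).
Hypotheses (sepX : points_separated X) (sepY : points_separated Y).
Hypotheses (bS : bounded_op S) (bT : bounded_op T).
Hypothesis chS : chain_complement S T (dXt D) (dYt D) p.
Hypothesis chT : chain_complement T S (dYt D) (dXt D) p.
Hypothesis spE : splitting_space S T (dXt D) (dYt D) (dX2 D).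
Hypothesis spF : splitting_space T S (dYt D) (dXt D) (dY2 D).
Hypothesis dsN : direct_sum (nullspace S) [:: nullspace S `&` range T; dX1 D].
Hypotheses (fX1 : finite_dim (dX1 D)) (cXt : closed (dXt D)).
Hypothesis cSXt : closed (S @` dXt D).
Hypothesis bXt : exists C : K, forall x, dXt D x -> `|x| <= C * `|S x|.
Hypothesis fR2 : finite_dim (iter_range S T 2).
Hypothesis p2 : (2 <= p)%N.

Let sT n : linear_subspace (tRT S T D n).
Proof. by apply: tilde_range_subspace; [case: chT|case: chS]. Qed.

Let sS n : linear_subspace (tRS S T D n).
Proof. by apply: tilde_range_subspace; [case: chS|case: chT]. Qed.

Let sX2 : linear_subspace (dX2 D). Proof. by case: spE. Qed.
Let sY2 : linear_subspace (dY2 D). Proof. by case: spF. Qed.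

Let sNS : linear_subspace (nullspace S).
Proof. by apply: subspace_nullspace; exact: linearP. Qed.
Let sNT : linear_subspace (nullspace T).
Proof. by apply: subspace_nullspace; exact: linearP. Qed.

Let sbbN n : linear_subspace (bbN S T D n).
Proof. exact: subspaceI. Qed.
Let sbbM n : linear_subspace (bbM S T D n).
Proof. exact: subspaceI. Qed.
Let sspX2 n : linear_subspace (spX2 S T D n).
Proof. by apply: subspaceI => //; exact: iter_range_subspace. Qed.
Let sspY2 n : linear_subspace (spY2 S T D n).
Proof. by apply: subspaceI => //; exact: iter_range_subspace. Qed.
Let sbbX2 n : linear_subspace (bbX2 S T D n).
Proof. exact: subspaceI. Qed.
Let sbbY2 n : linear_subspace (bbY2 S T D n).
Proof. exact: subspaceI. Qed.

Let fd_closedX A : linear_subspace A -> A `<=` dX2 D -> closed A.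
Proof.
move=> sA AX2; apply: finite_dim_closed => //.
by apply: finite_dim_sub AX2 => //; case: spE.
Qed.

Let fd_closedY A : linear_subspace A -> A `<=` dY2 D -> closed A.
Proof.
move=> sA AY2; apply: finite_dim_closed => //.
by apply: finite_dim_sub AY2 => //; case: spF.
Qed.

Let closed_tRS_sub n A : linear_subspace A -> A `<=` tRS S T D n.+2 -> closed A.
Proof.
move=> sA At; apply: finite_dim_closed => //; apply: finite_dim_sub fR2 _ => //.
apply: (subset_trans At); apply: subset_trans (@tilde_range_sub _ _ _ _ _ _ _ _) _.
exact: (iter_range_le (m := 2)).
Qed.

Let bounded_below_X2 A : A `<=` dX2 D ->
  exists C : K, forall x, A x -> `|x| <= C * `|S x|.
Proof.
move=> AX2; have [_ _ fX2 E0 _] := spE.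
have [C CX] := finite_dim_bounded_below sepY (@linearP _ _ _ _ S) fX2 E0.
by exists C => x /AX2; exact: CX.
Qed.

Let closed_bbM1 : closed (bbM S T D 1).
Proof.
apply: closedI => //; apply: closed_nullspace; exact: bounded_op_linear.
Qed.

Let closed_bbY2 n : closed (bbY2 S T D n).
Proof. by apply: fd_closedY => // x [_ []]. Qed.

(** [S] is bounded below on the whole tilde space, so it restricts to an isomorphism
over every closed subspace of its image; both XtN and Xt2 are of this form. *)
Let preimage_iso B : linear_subspace B -> closed B -> B `<=` tRS S T D 1 ->
  banach_iso S [set x | dXt D x /\ B (S x)] B.
Proof.
move=> sB cB BS; have [C CX] := bXt; have [sXt _] := chS.
have -> : [set x | dXt D x /\ B (S x)] = dXt D `&` S @^-1` B by [].
apply: banach_isoI => //.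
- by apply: subspaceI => //; apply: subspace_preimage => //; exact: linearP.
- apply: closedI => //; apply: closed_comp => // x _.
  have cS := bounded_linear_is_continuous (bounded_op_linear bS).
  exact: cS.
- apply/seteqP; split=> [_ [x [_ Bx] <-]//|y By].
  by have [x Xx xy] := BS y By; exists x => //; split=> //; rewrite /preimage /= xy.
- by exists C => x [Xx _]; exact: CX.
Qed.

Lemma tilde_decomposition : direct_sum (dXt D) [:: XtN S T D; Xt2 S T D].
Proof.
have [sXt _] := chS.
have [_ SE S0] := direct_sum2E (direct_sum_tilde chT chS spF (n := 1) isT).
apply: direct_sum2I => //.
- by have [[]] := preimage_iso (sbbM 1) closed_bbM1 (fun x Bx => proj1 Bx).
- by have [[]] := preimage_iso (sbbY2 1) (@closed_bbY2 1) (fun x Bx => proj1 Bx).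
- by move=> x [].
- by move=> x [].
- move=> x Xx; have tSx : tilde_range S T (dXt D) (dYt D) 1 (S x) by exists x.
  have [a [b [aM bY ab]]] := SE _ tSx.
  have [x1 X1 ax1] := aM.1; have [x2 X2 bx2] := bY.1.
  exists x1, x2; split; [by split=> //; rewrite ax1|by split=> //; rewrite bx2|].
  apply/eqP; rewrite -subr_eq0; apply/eqP; apply: (injective_tilde chS).
    by apply: subspaceB => //; exact: subspaceD.
  by rewrite linearB linearD ax1 bx2 ab subrr.
- move=> x [Xx Mx] [_ Yx]; apply: (injective_tilde chS) => //.
  exact: S0.
Qed.

Lemma domain_decomposition : direct_sum setT
  ((dX1 D :: [seq bbN S T D i | i <- index_iota 1 p])
   ++ (spX2 S T D p.-1 :: [seq bbX2 S T D i | i <- index_iota 1 p.-1])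
   ++ [:: XtN S T D; Xt2 S T D]).
Proof.
have [sXt _] := chS; have sX1 := finite_dim_subspace fX1.
have [dT dC] := direct_sum_complement chS spE.
have p1 : (1 <= p)%N by exact: ltnW.
have sC : linear_subspace (sums [:: dX2 D; dXt D]).
  by apply: subspace_sums; do 2 constructor=> //.
apply: (direct_sum_cat _ sC) dT _ _.
- exact: subspaceT.
- constructor=> //; rewrite /index_iota.
  by elim: (iota _ _) => [|i s IH] /=; constructor.
- have [NI NE N0] := direct_sum2E dsN.
  apply: (direct_sum_cons (C := nullspace S `&` range T)).
    have sV : linear_subspace (nullspace S `&` range T).
      by apply: subspaceI => //; apply: subspace_image => //; exact: linearP.
    apply: direct_sum2I => //.
    + by move=> x X1x; rewrite -[x]add0r; apply: NI => //; exact: sV.1.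
    + by move=> x /NE[b [c [Vb X1c <-]]]; exists c, b; rewrite addrC.
    + by move=> x X1x Vx; exact: N0.
  rewrite setIC; apply: (direct_sum_kernel_chain chS chT (n := 1)) => //.
  by rewrite subnKC.
- have sX2n i : linear_subspace (tilde_range T S (dYt D) (dXt D) i `&`
      (iter_range T S i `&` dX2 D)) by exact: (@sbbX2 i).
  apply: (direct_sum_cat _ sXt) dC _ _ => //.
  + constructor=> //; rewrite /index_iota.
    by elim: (iota _ _) => [|i s IH] /=; constructor.
  + have [_ ET _ _ _] := spE.
    have := direct_sum_splitting_chain chS chT spE (p.-1 - 1) (n := 1) isT.
    rewrite subnKC; last by rewrite -ltnS prednK.
    have -> // : iter_range T S 1 `&` dX2 D = dX2 D by exact: setIidr.
  + exact: tilde_decomposition.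
Qed.

Lemma kernel_part x :
  sums (dX1 D :: [seq bbN S T D i | i <- index_iota 1 p]) x -> S x = 0.
Proof.
move=> [a X1a [b Nb <-]]; rewrite linearD.
have [NI _ _] := direct_sum2E dsN.
have -> : S a = 0.
  have := NI 0 a; rewrite add0r; apply=> //.
  by split; [exact: sNS.1|exists 0 => //; rewrite linear0].
have -> : S b = 0; last by rewrite addr0.
elim: (index_iota 1 p) b Nb => [_ ->|i s IH b /= [c [_ Sc] [d Nd <-]]].
  by rewrite linear0.
by rewrite linearD Sc IH// addr0.
Qed.

(** [R_{p-1}] and [R_p] meet [X_2] in the same space: at level [p - 1] the tilde
range lies in the kernel. *)
Lemma stable_part_iso : banach_iso S (spX2 S T D p.-1) (spY2 S T D p.-1).
Proof.
have p1 : (1 <= p)%N by exact: ltnW.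
apply: banach_isoI => //.
- by apply: fd_closedX => // x [].
- by apply: fd_closedY => // x [].
- rewrite (image_splitting_last spE p2); apply/seteqP; split=> [y Ry|y].
    split; last exact: (range_sub_splitting chS spF p1).
    by apply: iter_range_decr; rewrite prednK.
  exact: (splitting_last chT chS spF p1).
- by apply: bounded_below_X2 => x [].
Qed.

Let sums_bb n : sums [:: bbM S T D n.+1; bbY2 S T D n.+1] = tRS S T D n.+1.
Proof. by have [<-] := direct_sum_tilde chT chS spF (n := n.+1) isT. Qed.

Lemma middle_iso i : (1 <= i)%N ->
  independent [:: bbM S T D i.+1; bbY2 S T D i.+1] /\
  banach_iso S (bbX2 S T D i) (sums [:: bbM S T D i.+1; bbY2 S T D i.+1]).
Proof.
move=> i1; split.
  by have [_] := direct_sum_tilde chT chS spF (n := i.+1) isT.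
rewrite sums_bb; apply: banach_isoI => //.
- by apply: fd_closedX => // x [_ []].
- case: i i1 => // i _; apply: (@closed_tRS_sub i) => //; exact: sS.
- exact: (image_splitting_tilde spE).
- by apply: bounded_below_X2 => x [_ []].
Qed.

Lemma bbY2_last n : (p <= n.+1)%N -> bbY2 S T D n = [set 0].
Proof.
move=> pn; apply/seteqP; split=> [y|_ ->]; last exact: (sbbY2 n).1.
exact: (splitting_tilde_last chT spF).
Qed.

Lemma bbX2_last n : (p <= n.+1)%N -> bbX2 S T D n = [set 0].
Proof.
move=> pn; apply/seteqP; split=> [y|_ ->]; last exact: (sbbX2 n).1.
exact: (splitting_tilde_last chS spE).
Qed.

Lemma last_iso : (1 <= p - 2)%N ->
  banach_iso S (bbX2 S T D (p - 2)) (bbM S T D p.-1).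
Proof.
move=> p3; have [_] := middle_iso p3.
have -> : (p - 2).+1 = p.-1 by rewrite -subSn // subSS subn1.
have -> // : sums [:: bbM S T D p.-1; bbY2 S T D p.-1] = bbM S T D p.-1.
rewrite (@bbY2_last p.-1) ?prednK//; last exact: ltnW.
apply/seteqP; split=> [_ [x Mx [_ [_ -> [_ -> <-]] <-]]|x Mx].
  by rewrite !addr0.
by exists x => //; exists 0; [exists 0 => //; exists 0 => //|]; rewrite addr0.
Qed.

Lemma top_iso : banach_iso S (XtN S T D) (bbM S T D 1) /\
  banach_iso S (Xt2 S T D) (bbY2 S T D 1).
Proof.
split; apply: preimage_iso => //; by move=> x [].
Qed.

Lemma number_two : p = 2%N -> bbX2 S T D 1 = [set 0] /\ Xt2 S T D = [set 0].
Proof.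
move=> pE; split; first by apply: bbX2_last; rewrite pE.
rewrite /Xt2 bbY2_last ?pE//; have [sXt _] := chS.
apply/seteqP; split=> [x [Xx Sx]|_ ->]; first exact: (injective_tilde chS).
by split; [exact: sXt.1|rewrite linear0].
Qed.

End HalfConclusions.

(** * Existence of the adapted system *)

(** Stability makes [T \o S] map the finite dimensional stable range onto itself. *)
Lemma iter_range_injective (K : numFieldType) (X Y : normedModType K)
    (S : {linear X -> Y}) (T : {linear Y -> X}) p :
  (2 <= p)%N -> finite_dim_quotient (range S) (nullspace T `&` range S) ->
  (forall n, (p <= n)%N -> iter_range T S n = iter_range T S p) ->
  forall x, iter_range T S p x -> S x = 0 -> x = 0.
Proof.
move=> p2 qS stab x Rx Sx.
have fR : finite_dim (iter_range T S p).
  apply: (finite_dim_sub _ (finite_dim_second_range qS)).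
    exact: iter_range_subspace.
  exact: (iter_range_le (m := 2)).
have TSR : (T \o S) @` iter_range T S p = iter_range T S p.
  by rewrite -image_comp -[RHS](stab p.+2) ?leqW.
apply: (surjective_endo_inj _ fR TSR Rx); last by rewrite /= Sx linear0.
by move=> a u v; rewrite /= !linearP.
Qed.

Lemma chain_complement_projection (K : numFieldType) (X Y : normedModType K)
    (S : {linear X -> Y}) (T : {linear Y -> X}) (f : X -> X) (Yt : set Y) p :
  bounded_linear f -> (forall x, f (f x) = f x) ->
  (forall x, f x = 0 <-> exists2 r, range T r & S (x - r) = 0) ->
  linear_subspace Yt -> straight S T (range f) p -> straight T S Yt p ->
  (forall n, (p <= n)%N -> iter_range S T n = iter_range S T p) ->
  (forall n, (p <= n)%N -> iter_range T S n = iter_range T S p) ->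
  (forall y, iter_range S T p y -> T y = 0 -> y = 0) ->
  chain_complement S T (range f) Yt p.
Proof.
move=> bf ff kerf sY stX stY stabS stabT inj.
have [F FE] := packed_linear bf.1.
have sX : linear_subspace (range f) by exact: subspace_image bf.1 (@subspaceT _ _).
split=> //; split=> //.
- move=> x; have /kerf[r Tr Sx] : f (x - f x) = 0.
    by rewrite -FE linearB FE ff subrr.
  exists r, (f x); split=> //.
  by rewrite opprD addrA addrAC.
- move=> _ r [x _ <-] Tr Sxr; rewrite -ff; apply/kerf; by exists r.
- move=> n v tv Rv; have [np|pn] := leqP n p.
    exact: (straight_inter sX.1 sY.1 stX stY np tv Rv).
  (* Beyond [p] the tilde ranges vanish, since at [p] they lie in the next range. *)
  have vanS y : tilde_range S T (range f) Yt p y -> y = 0.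
    move=> ty; apply: (straight_inter sX.1 sY.1 stX stY (leqnn p) ty).
    by rewrite stabS ?leqW//; exact: tilde_range_sub ty.
  have vanT x : tilde_range T S Yt (range f) p x -> x = 0.
    move=> tx; apply: (straight_inter sY.1 sX.1 stY stX (leqnn p) tx).
    by rewrite stabT ?leqW//; exact: tilde_range_sub tx.
  suff : (forall y, tilde_range S T (range f) Yt n y -> y = 0) /\
    (forall x, tilde_range T S Yt (range f) n x -> x = 0) by case=> h _; exact: h.
  rewrite -(subnK (ltnW pn)); elim: (n - p)%N => [//|k [IHS IHT]].
  by split=> _ [z tz <-]; [rewrite (IHT z tz) linear0|rewrite (IHS z tz) linear0].
Qed.

(** With [S' : Y -> X] a generalized inverse of [S], the operator [f \o S'] inverts [S]
on the range of [f], which gives the bound; the image of that range is the fixed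
space of [S \o f \o S']. *)
Lemma complement_topology (K : numFieldType) (X Y : normedModType K)
    (S : {linear X -> Y}) (f : X -> X) :
  bounded_op S -> regular_op S -> bounded_linear f ->
  (forall x, f (f x) = f x) -> (forall x, S x = 0 -> f x = 0) ->
  [/\ closed (range f), closed (S @` range f) &
    exists C : K, forall x, range f x -> `|x| <= C * `|S x|].
Proof.
move=> bS [S' [bS' SS'S]] bf ff Sf.
have [F FE] := packed_linear bf.1.
have bg : bounded_linear (f \o S').
  exact: bounded_linear_comp bf (bounded_op_linear bS').
have gS x : range f x -> f (S' (S x)) = x.
  move=> [y _ <-]; rewrite -[RHS]ff; apply/eqP.
  rewrite -subr_eq0 -FE -linearB FE; apply/eqP/Sf.
  by rewrite linearB SS'S subrr.
split.
- have -> : range f = [set x | f x = x].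
    by apply/seteqP; split=> [_ [x _ <-]|x /= <-]; [exact: ff|exists x].
  exact: closed_equalizer bf (bounded_linear_id _).
- have -> : S @` range f = [set y | S (f (S' y)) = y].
    apply/seteqP; split=> [_ [x Xx <-] /=|y /= <-]; first by rewrite gS.
    by exists (f (S' y)) => //; exists (S' y).
  apply: closed_equalizer (bounded_linear_id _).
  exact: bounded_linear_comp (bounded_op_linear bS) bg.
- have [_ [C _ gC]] := bg; exists C => x Xx.
  by rewrite -{1}(gS x Xx); exact: gC.
Qed.

Lemma chain_complement_decomposition (K : numFieldType) (X Y : normedModType K)
    (S : {linear X -> Y}) (T : {linear Y -> X}) (X1 X2 Xt : set X) (Yt : set Y) p :
  chain_complement S T Xt Yt p -> chain_complement T S Yt Xt p ->
  splitting_space S T Xt Yt X2 -> finite_dim X1 ->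
  direct_sum (nullspace S) [:: nullspace S `&` range T; X1] -> closed Xt ->
  half_decomposition S T X1 X2 Xt.
Proof.
move=> chS chT spE fX1 dsN cXt; have [sE ET fE _ _] := spE.
have [sXt _] := chS.
have sV : linear_subspace (nullspace S `&` range T).
  apply: subspaceI; first by apply: subspace_nullspace; exact: linearP.
  by apply: subspace_image => //; exact: linearP.
split=> //.
  have := direct_sum_range spE (n := 1) isT.
  by rewrite [_ `&` X2](setIidr ET) setIC.
have [dT dC] := direct_sum_complement chS spE.
apply: (direct_sum_cat (s1 := [:: _; _]) _ _ _ dT dsN dC) => //.
- by apply: subspace_sums; do 2 constructor=> //.
- by do 2 constructor=> //; exact: finite_dim_subspace.
Qed.

Theorem theorem3p10 (K : numFieldType) (hK : real_or_complex K)
    (X Y : completeNormedModType K)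
    (S : {linear X -> Y}) (T : {linear Y -> X}) (p : nat)
    (hST : regular_fredholm_pair S T)
    (hcase : has_case S T CaseI p) (hp : (2 <= p)%N) :
  exists D : decomp_data X Y,
    (decomposition_system S T D /\ adapted S T D) /\
    direct_sum setT
      ((dX1 D :: [seq bbN S T D i | i <- index_iota 1 p])
       ++ (spX2 S T D p.-1 :: [seq bbX2 S T D i | i <- index_iota 1 p.-1])
       ++ [:: XtN S T D; Xt2 S T D]) /\
    direct_sum setT
      ((dY1 D :: [seq bbM S T D i | i <- index_iota 1 p])
       ++ (spY2 S T D p.-1 :: [seq bbY2 S T D i | i <- index_iota 1 p.-1])
       ++ [:: YtN S T D; Yt2 S T D]) /\
    [/\ forall x, sums (dX1 D :: [seq bbN S T D i | i <- index_iota 1 p]) x ->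
          S x = 0,
        banach_iso S (spX2 S T D p.-1) (spY2 S T D p.-1),
        forall i, (1 <= i <= p - 3)%N ->
          independent [:: bbM S T D i.+1; bbY2 S T D i.+1] /\
          banach_iso S (bbX2 S T D i)
            (sums [:: bbM S T D i.+1; bbY2 S T D i.+1]),
        (1 <= p - 2)%N -> banach_iso S (bbX2 S T D (p - 2)) (bbM S T D p.-1) &
        banach_iso S (XtN S T D) (bbM S T D 1) /\
        banach_iso S (Xt2 S T D) (bbY2 S T D 1)] /\
    [/\ forall y, sums (dY1 D :: [seq bbM S T D i | i <- index_iota 1 p]) y ->
          T y = 0,
        banach_iso T (spY2 S T D p.-1) (spX2 S T D p.-1),
        forall i, (1 <= i <= p - 3)%N ->
          independent [:: bbN S T D i.+1; bbX2 S T D i.+1] /\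
          banach_iso T (bbY2 S T D i)
            (sums [:: bbN S T D i.+1; bbX2 S T D i.+1]),
        (1 <= p - 2)%N -> banach_iso T (bbY2 S T D (p - 2)) (bbN S T D p.-1) &
        banach_iso T (YtN S T D) (bbN S T D 1) /\
        banach_iso T (Yt2 S T D) (bbX2 S T D 1)] /\
    (p = 2%N ->
      [/\ bbX2 S T D 1 = [set 0], bbY2 S T D 1 = [set 0],
          Xt2 S T D = [set 0] & Yt2 S T D = [set 0]]).
Proof.
have [bS bT [qNS qRT qNT qRS] rS rT] := hST.
have [p' [q [[_ stp _] [_ stq _] pE pq]]] := hcase.
have p'p : p' = p by rewrite pE -pq minnn.
subst q p'; clear pE hcase.
have stabS n : (p <= n)%N -> iter_range S T n = iter_range S T p.
  by move=> pn; rewrite (stp (n - p)%N) subnKC.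
have stabT n : (p <= n)%N -> iter_range T S n = iter_range T S p.
  by move=> pn; rewrite (stq (n - p)%N) subnKC.
have injT := iter_range_injective hp qRS stabT.
have injS := iter_range_injective hp qRT stabS.
have [f [bf ff kerf stf]] := straight_complement hK p bS bT rS qRT.
have [g [bg gg kerg stg]] := straight_complement hK p bT bS rT qRS.
have sepX := banach_points_separated (V := X) hK.
have sepY := banach_points_separated (V := Y) hK.
have chS : chain_complement S T (range f) (range g) p.
  apply: chain_complement_projection => //.
  exact: subspace_image bg.1 (@subspaceT _ _).
have chT : chain_complement T S (range g) (range f) p.
  apply: chain_complement_projection => //.
  exact: subspace_image bf.1 (@subspaceT _ _).
have p0 : (0 < p)%N by exact: ltnW.
have [X2 spE] := exists_splitting_space chS chT p0 qRT.
have [Y2 spF] := exists_splitting_space chT chS p0 qRS.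
have [X1 [fX1 dX1]] : exists X1, finite_dim X1 /\
    direct_sum (nullspace S) [:: nullspace S `&` range T; X1].
  have [n [v [_ vN]]] := qNS.
  have [|C [fC _ dC]] := finite_dim_complement (v := v)
    (subspace_nullspace (@linearP _ _ _ _ S))
    (subspace_image (@linearP _ _ _ _ T) (@subspaceT _ _)).
    by move=> x /vN[a [_ Ta]]; exists a.
  by exists C.
have [Y1 [fY1 dY1]] : exists Y1, finite_dim Y1 /\
    direct_sum (nullspace T) [:: nullspace T `&` range S; Y1].
  have [n [v [_ vN]]] := qNT.
  have [|C [fC _ dC]] := finite_dim_complement (v := v)
    (subspace_nullspace (@linearP _ _ _ _ T))
    (subspace_image (@linearP _ _ _ _ S) (@subspaceT _ _)).
    by move=> x /vN[a [_ Ta]]; exists a.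
  by exists C.
have Sf x : S x = 0 -> f x = 0.
  move=> Sx; apply/kerf; exists 0; last by rewrite subr0.
  by exists 0 => //; rewrite linear0.
have Tg y : T y = 0 -> g y = 0.
  move=> Ty; apply/kerg; exists 0; last by rewrite subr0.
  by exists 0 => //; rewrite linear0.
have [cX cSX bX] := complement_topology bS rS bf ff Sf.
have [cY cTY bY] := complement_topology bT rT bg gg Tg.
have fRS : finite_dim (iter_range S T 2) := finite_dim_second_range qRT.
have fRT : finite_dim (iter_range T S 2) := finite_dim_second_range qRS.
pose D := DecompData X1 X2 (range f) Y1 Y2 (range g).
(* The same system seen from [T]: the associated spaces of [D'] for [(T, S)] are
   convertible to those of [D] for [(S, T)]. *)
pose D' := DecompData Y1 Y2 (range g) X1 X2 (range f).
exists D; split; last first.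
  split.
    exact: (@domain_decomposition _ _ _ S T D p).
  split.
    exact: (@domain_decomposition _ _ _ T S D' p).
  split.
    split.
    + exact: (@kernel_part _ _ _ S T D p).
    + exact: (@stable_part_iso _ _ _ S T D p).
    + by move=> i /andP[i1 _]; exact: (@middle_iso _ _ _ S T D p).
    + exact: (@last_iso _ _ _ S T D p).
    + exact: (@top_iso _ _ _ S T D p).
  split.
    split.
    + exact: (@kernel_part _ _ _ T S D' p).
    + exact: (@stable_part_iso _ _ _ T S D' p).
    + by move=> i /andP[i1 _]; exact: (@middle_iso _ _ _ T S D' p).
    + exact: (@last_iso _ _ _ T S D' p).
    + exact: (@top_iso _ _ _ T S D' p).
  move=> p2; have [X21 Xt2] := @number_two _ _ _ S T D p chS chT spE spF p2.
  have [Y21 Yt2] := @number_two _ _ _ T S D' p chT chS spF spE p2.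
  by split.
split.
  split; first exact: (chain_complement_decomposition chS chT spE fX1 dX1 cX).
  exact: (chain_complement_decomposition chT chS spF fY1 dY1 cY).
move=> n n1; split.
- split; first exact: (direct_sum_range spF).
  exact: (direct_sum_range spE).
- exact: (direct_sum_tilde chT chS spF).
- exact: (direct_sum_tilde chS chT spE).
- exact: (direct_sum_step chT chS).
- exact: (direct_sum_step chS chT).
Qed.
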